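(* Let $\epsilon>0$, $T>0$ and consider the diffusion $dX^\epsilon(t)=b^\epsilon(X^\epsilon(t))dt+\sqrt\epsilon\,dB(t)$ on $\mathbb R^d$ with time-independent drift $b^\epsilon:\mathbb R^d\to\mathbb R^d$, with arbitrary initial distribution, under the standing assumptions given in the context. Let $\nu^\epsilon$ be the law of $X^\epsilon$ on $C([0,T];\mathbb R^d)$. Then the ensemble average of the total entropy production over $[0,T]$ is nonnegative: $$\mathbf E_{\nu^\epsilon}\big[s_{\mathrm{tot}}(T,\omega)-s_{\mathrm{tot}}(0,\omega)\big]\ge0.$$
   Context: $\rho^\epsilon(t,\cdot)$, $t\in[0,T]$, denotes the probability density of $X^\epsilon(t)$. Current and velocity: $j^\epsilon=b^\epsilon\rho^\epsilon-\frac\epsilon2\nabla\rho^\epsilon$, $v^\epsilon(t,x)=b^\epsilon(x)-\frac\epsilon2\nabla\log\rho^\epsilon(t,x)=j^\epsilon/\rho^\epsilon$. The total entropy production is defined by $$ds_{\mathrm{tot}}(t,\omega)=\frac{(\partial_t\rho^\epsilon)(T-t,\omega(t))}{\rho^\epsilon(T-t,\omega(t))}dt+\frac2\epsilon\frac{j^\epsilon(T-t,\omega(t))}{\rho^\epsilon(T-t,\omega(t))}\circ d\omega(t),$$ and $s_{\mathrm{tot}}(T,\omega)-s_{\mathrm{tot}}(0,\omega)=\int_0^Tds_{\mathrm{tot}}(t,\omega)$. Here $\circ$ is the Stratonovich differential: $\int F(t,\omega(t))\circ d\omega(t)=\int F(t,\omega(t))\cdot d\omega(t)+\frac\epsilon2\int(\nabla\cdot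 F)(t,\omega(t))dt$. Standing assumptions: $b^\epsilon$ is $C^1$; $\rho^\epsilon$ is strictly positive, $C^{1,2}$ on $[0,T]\times\mathbb R^d$ and satisfies the Fokker--Planck equation $\partial_t\rho^\epsilon=-\nabla\cdot[(b^\epsilon-\frac\epsilon2\nabla\log\rho^\epsilon)\rho^\epsilon]$. Write $\nu^\epsilon_x=\nu^\epsilon(\cdot|\omega(0)=x)$; let $\overleftarrow\nu^\epsilon$ be the image of $\nu^\epsilon$ under time reversal $\omega\mapsto\omega(T-\cdot)$ and $\overleftarrow\nu^\epsilon_x=\overleftarrow\nu^\epsilon(\cdot|\omega(0)=x)$. The time-reversed process is a weak solution of the SDE with drift $-b^\epsilon(x)+\epsilon\nabla\log\rho^\epsilon(T-t,x)$ and noise $\sqrt\epsilon\,d\widetilde B$, and for a.e. $x$ the measures $\nu^\epsilon_x$, $\overleftarrow\nu^\epsilon_x$ and the law $\mu^\epsilon_x$ of $x+\sqrt\epsilon B$ are mutually equivalent, with $\frac{d\nu_x^\epsilon}{d\mu_x^\epsilon}$, $\frac{d\overleftarrow\nu_x^\epsilon}{d\mu_x^\epsilon}$ given by Girsanov's formula $\exp(\frac1\epsilon\int\beta\cdot d\omega-\frac1{2\epsilon}\int|\beta|^2dt)$ for the respective drifts $\beta$. *)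

(* Defs.v *)
From HB Require Import structures.
From mathcomp Require Import all_boot all_order all_algebra.
From mathcomp Require Import all_classical all_reals all_analysis.
From mathcomp Require Import measurable_realfun lra.

Set Implicit Arguments.
Unset Strict Implicit.
Unset Printing Implicit Defensive.

Import Order.TTheory GRing.Theory Num.Theory.
Import numFieldNormedType.Exports.

Local Open Scope classical_set_scope.
Local Open Scope ring_scope.

Section state_space.
Context {R : realType} {d : nat}.

Definition rV_cylinder : set (set 'rV[R]_d) :=
  [set A | exists i (C : set R), measurable C /\ A = [set x : 'rV[R]_d | C (x ord0 i)]].

Let rV_set0 : <<s rV_cylinder >> set0.
Proof. exact: sigma_algebra0. Qed.

Let rV_setC A : <<s rV_cylinder >> A -> <<s rV_cylinder >> (~` A).
Proof. exact: sigma_algebraC. Qed.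

Let rV_bigcup (F : (set 'rV[R]_d)^nat) : (forall k, <<s rV_cylinder >> (F k)) ->
  <<s rV_cylinder >> (\bigcup_k F k).
Proof. exact: sigma_algebra_bigcup. Qed.

HB.instance Definition _ := @isMeasurable.Build default_measure_display
  'rV[R]_d <<s rV_cylinder >> rV_set0 rV_setC rV_bigcup.

Lemma measurable_coord (i : 'I_d) :
  measurable_fun [set: 'rV[R]_d] (fun x => x ord0 i).
Proof.
by move=> _ C mC; rewrite setTI; apply: sub_sigma_algebra; exists i, C.
Qed.

Lemma measurable_fun_rV d0 (T : measurableType d0) (f : T -> 'rV[R]_d) :
  (forall i, measurable_fun setT (fun x => f x ord0 i)) -> measurable_fun setT f.
Proof.
move=> mf; apply: (measurability rV_cylinder) => // A [B [i [C [mC ->]] <-]].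
exact: (mf i).
Qed.

End state_space.

Section lebesgue_rV_step.
Context {R : realType} (n : nat).
Variable m : {sigma_finite_measure set 'rV[R]_n -> \bar R}.

Definition rV_cons (p : R * 'rV[R]_n) : 'rV[R]_n.+1 :=
  \row_i (if unlift ord0 i is Some k then p.2 ord0 k else p.1).

Definition rV_uncons (x : 'rV[R]_n.+1) : R * 'rV[R]_n :=
  (x ord0 ord0, \row_j x ord0 (lift ord0 j)).

Lemma rV_cons0 p : rV_cons p ord0 ord0 = p.1.
Proof. by rewrite mxE unlift_none. Qed.

Lemma rV_consS p (k : 'I_n) : rV_cons p ord0 (lift ord0 k) = p.2 ord0 k.
Proof. by rewrite mxE liftK. Qed.

Lemma rV_consK : cancel rV_cons rV_uncons.
Proof.
case=> a v; rewrite /rV_uncons rV_cons0; congr pair.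
by apply/rowP => j; rewrite mxE rV_consS.
Qed.

Lemma measurable_rV_cons : measurable_fun setT rV_cons.
Proof.
apply: measurable_fun_rV => i.
case: (unliftP ord0 i) => [k|] ->.
  rewrite (_ : (fun _ => _) = (fun x : 'rV[R]_n => x ord0 k) \o snd).
    by apply: measurableT_comp => //; exact: measurable_coord.
  by apply/funext => p; rewrite rV_consS.
by rewrite (_ : (fun _ => _) = fst)//; apply/funext => p; rewrite rV_cons0.
Qed.

Lemma measurable_rV_uncons : measurable_fun setT rV_uncons.
Proof.
apply: measurable_fun_pair; first exact: measurable_coord.
apply: measurable_fun_rV => i.
rewrite (_ : (fun _ => _) = fun x : 'rV[R]_n.+1 => x ord0 (lift ord0 i)).
  exact: measurable_coord.
by apply/funext => x /=; rewrite mxE.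
Qed.

Definition lebesgue_rV_step : set 'rV[R]_n.+1 -> \bar R :=
  pushforward (lebesgue_measure \x m)%E rV_cons.

Let step_measure := @measure_function_pushforward__canonical__measure_function_Measure
  _ _ _ _ _ (lebesgue_measure \x m)%E _ measurable_rV_cons.

HB.instance Definition _ := isMeasure.Build _ _ _ lebesgue_rV_step
  (@measure0 _ _ _ step_measure) (@measure_ge0 _ _ _ step_measure)
  (@measure_semi_sigma_additive _ _ _ step_measure).

Let sigma_finite_step : sigma_finite setT lebesgue_rV_step.
Proof.
have [F FT mF] : sigma_finite setT (lebesgue_measure \x m)%E.
  have /sigma_finiteP[F [TF ndF Foo]] := sigma_finiteT (@lebesgue_measure R).
  have /sigma_finiteP[G [TG ndG Goo]] := sigma_finiteT m.
  exists (fun n => F n `*` G n).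
    rewrite -setXTT TF TG predeqE => -[x y]; split.
      move=> [/= [i _ Fi] [k _ Gk]]; exists (maxn i k) => //; split.
        by move: x Fi; exact/subsetPset/ndF/leq_maxl.
      by move: y Gk; exact/subsetPset/ndG/leq_maxr.
    by move=> [i _ []/= ? ?]; split; exists i.
  move=> k; have [? ?] := Foo k; have [? ?] := Goo k.
  split; first exact: measurableX.
  by rewrite product_measure1E// lte_mul_pinfty// ge0_fin_numE.
exists (fun k => rV_uncons @^-1` F k).
  rewrite -preimage_bigcup -FT.
  by rewrite preimage_setT.
move=> k; split.
  rewrite -[X in measurable X]setTI; apply: measurable_rV_uncons => //.
  by case: (mF k).
rewrite /lebesgue_rV_step /pushforward -comp_preimage.
rewrite (_ : rV_uncons \o rV_cons = id); first by case: (mF k).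
by apply/funext => p /=; rewrite rV_consK.
Qed.

HB.instance Definition _ := Measure_isSigmaFinite.Build _ _ _
  lebesgue_rV_step sigma_finite_step.

End lebesgue_rV_step.

Fixpoint lebesgue_rV {R : realType} (n : nat) :
    {sigma_finite_measure set 'rV[R]_n -> \bar R} :=
  match n with
  | 0%N => dirac (0 : 'rV[R]_0)
  | n'.+1 => lebesgue_rV_step (lebesgue_rV n')
  end.

(* An element of C([0,T]; R^d) is represented by its extension to the real line
   that is constant on each side of [0,T]; the sigma-algebra is the one
   generated by the evaluations w(t), t in [0,T], i.e. the Borel one for
   uniform convergence. *)

Definition clamp {R : realType} (T t : R) : R := Num.max 0 (Num.min t T).

Record cpath {R : realType} (T : R) (d : nat) := CPath {
  cpath_fun :> R -> 'rV[R]_d ;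
  cpath_continuous : continuous cpath_fun ;
  cpath_clamp : forall t, cpath_fun t = cpath_fun (clamp T t) }.

Section path_space.
Context {R : realType} (T : R) (d : nat).
Local Notation path := (cpath T d).

HB.instance Definition _ := gen_eqMixin path.
HB.instance Definition _ := gen_choiceMixin path.

Definition cpath0 : path.
Proof. by exists (fun _ => 0) => // t; exact: cvg_cst. Defined.

HB.instance Definition _ := isPointed.Build path cpath0.

Definition cpath_cylinder (I : set R) : set (set path) :=
  [set A | exists t i (C : set R),
    [/\ I t, measurable C & A = [set w : path | C (w t ord0 i)]]].

Definition path_sigma : set (set path) := <<s cpath_cylinder `[0, T] >>.

Let path_set0 : path_sigma set0.
Proof. exact: sigma_algebra0. Qed.

Let path_setC A : path_sigma A -> path_sigma (~` A).
Proof. exact: sigma_algebraC. Qed.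

Let path_bigcup (F : (set path)^nat) : (forall k, path_sigma (F k)) ->
  path_sigma (\bigcup_k F k).
Proof. exact: sigma_algebra_bigcup. Qed.

HB.instance Definition _ := @isMeasurable.Build default_measure_display
  path path_sigma path_set0 path_setC path_bigcup.

Definition natural_filtration (t : R) : set (set path) :=
  <<s cpath_cylinder `[0, t] >>.

Lemma clamp_itv t : 0 <= T -> clamp T t \in `[0, T].
Proof.
move=> T0; rewrite in_itv /= /clamp le_max lexx /= ge_max T0 /=.
by rewrite ge_min lexx orbT.
Qed.

Lemma clamp_rev t : 0 <= T -> clamp T (T - clamp T t) = clamp T (T - t).
Proof.
move=> T0; rewrite /clamp.
have [tT|Tt] := leP t T; last first.
  by rewrite (max_r T0) subrr !min_l ?max_l//; lra.
have [t0|t0] := leP 0 t; first by [].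
by rewrite subr0 minxx min_r//; lra.
Qed.

End path_space.

Section path_operations.
Context {R : realType} {T : R} {d : nat}.
Local Notation path := (cpath T d).

Lemma measurable_eval (t : R) (i : 'I_d) : 0 <= T ->
  measurable_fun [set: path] (fun w => w t ord0 i).
Proof.
move=> T0 _ C mC; rewrite setTI; apply: sub_sigma_algebra.
exists (clamp T t), i, C; split => //; first exact: clamp_itv.
by apply/seteqP; split => w /=; rewrite (cpath_clamp w t).
Qed.

Lemma measurable_fun_cpath d0 (S : measurableType d0) (f : S -> path) :
  (forall t i, 0 <= t <= T -> measurable_fun setT (fun o => f o t ord0 i)) ->
  measurable_fun setT f.
Proof.
move=> mf; apply: (measurability (cpath_cylinder `[0, T])) => //.
move=> A [B [t [i [C [tI mC ->]]]] <-].
by apply: (mf t i) => //; move: tI; rewrite /= in_itv.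
Qed.

Lemma affine_path_subproof (x : 'rV[R]_d) (a : R) (w : path) :
  continuous (fun t => x + a *: w t : 'rV[R]_d) /\
  (forall t, x + a *: w t = x + a *: w (clamp T t)).
Proof.
split=> t; last by rewrite (cpath_clamp w t).
apply: cvgD; first exact: cvg_cst.
apply: cvgZl_tmp; exact: cpath_continuous.
Qed.

Definition affine_path (x : 'rV[R]_d) (a : R) (w : path) : path :=
  CPath (affine_path_subproof x a w).1 (affine_path_subproof x a w).2.

Lemma time_reversal_subproof (w : path) : 0 <= T ->
  continuous (fun t => w (T - t)) /\
  (forall t, w (T - t) = w (T - clamp T t)).
Proof.
move=> T0; split=> t; last first.
  by rewrite [LHS]cpath_clamp [RHS]cpath_clamp clamp_rev.
apply: (@continuous_comp _ _ _ (fun t : R => T - t)).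
  by apply: cvgB; [exact: cvg_cst|exact: cvg_id].
exact: cpath_continuous.
Qed.

Definition time_reversal (T0 : 0 <= T) (w : path) : path :=
  CPath (time_reversal_subproof w T0).1 (time_reversal_subproof w T0).2.

Lemma measurable_time_reversal (T0 : 0 <= T) :
  measurable_fun [set: path] (time_reversal T0).
Proof. by apply: measurable_fun_cpath => t i _; exact: measurable_eval. Qed.

HB.instance Definition _ (T0 : 0 <= T) :=
  isMeasurableFun.Build _ _ _ _ (time_reversal T0) (measurable_time_reversal T0).

End path_operations.

Section calculus.
Context {R : realType} {d : nat}.
Local Notation E := 'rV[R]_d.

Definition partial (i : 'I_d) (f : E -> R) (x : E) : R :=
  'D_(delta_mx ord0 i) f x.

Definition grad (f : E -> R) (x : E) : E := \row_i partial i f x.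

Definition div (F : E -> E) (x : E) : R :=
  \sum_i partial i (fun y => F y ord0 i) x.

Definition sqnorm (x : E) : R := \sum_i x ord0 i ^+ 2.

Definition dot (x y : E) : R := \sum_i x ord0 i * y ord0 i.

Definition C1_field (b : E -> E) : Prop :=
  (forall x, differentiable b x) /\ (forall v, continuous ('D_v b)).

(* derivative in t relative to [0,T], hence one-sided at 0 and at T *)
Definition dt_quotient (rho : R -> E -> R) (t : R) (x : E) (s : R) : R :=
  (rho s x - rho t x) / (s - t).

Definition dt (T : R) (rho : R -> E -> R) (t : R) (x : E) : R :=
  lim (dt_quotient rho t x s @[s --> within `[0, T] t^']).

Definition cylinder_continuous (T : R) (f : R -> E -> R) : Prop :=
  {within `[0, T] `*` [set: E], continuous (fun p : R * E => f p.1 p.2)}.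

Definition C12 (T : R) (rho : R -> E -> R) : Prop :=
  [/\ forall t x, 0 <= t <= T ->
        cvg (dt_quotient rho t x s @[s --> within `[0, T] t^']),
      forall t x i, 0 <= t <= T -> derivable (rho t) x (delta_mx ord0 i),
      forall t x i j, 0 <= t <= T ->
        derivable (partial i (rho t)) x (delta_mx ord0 j) &
      [/\ cylinder_continuous T rho,
          cylinder_continuous T (dt T rho),
          forall i, cylinder_continuous T (fun t => partial i (rho t)) &
          forall i j,
            cylinder_continuous T (fun t => partial j (partial i (rho t)))]].

End calculus.

Section convergence_in_probability.
Context {R : realType} d0 (Om : measurableType d0) (P : probability Om R).
Local Open Scope ereal_scope.

Definition vanish_in_prob (Y : nat -> Om -> \bar R) : Prop :=
  forall delta : R, (0 < delta)%R ->
    P [set o | delta%:E <= `|Y n o|] @[n --> \oo] --> 0.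

Definition cvg_in_prob (Y : nat -> Om -> R) (Z : Om -> R) : Prop :=
  vanish_in_prob (fun n o => (Y n o - Z o)%:E).

End convergence_in_probability.

Section ito_integral.
Context {R : realType} (T : R) (d : nat).
Local Notation path := (cpath T d).
Local Notation E := 'rV[R]_d.

(* H = sum_k xi_k 1_(t_k, t_k+1] with xi_k measurable for F_(t_k) *)
Record simple_process := SimpleProcess {
  sp_size : nat ;
  sp_node : nat -> R ;
  sp_value : nat -> path -> E ;
  sp_node0 : sp_node 0 = 0 ;
  sp_nodeT : sp_node sp_size = T ;
  sp_node_le : forall k, (k < sp_size)%N -> sp_node k <= sp_node k.+1 ;
  sp_adapted : forall k i (C : set R), (k < sp_size)%N -> measurable C ->
    natural_filtration (sp_node k) [set w | C (sp_value k w ord0 i)] }.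

Definition sp_process (H : simple_process) (t : R) (w : path) : E :=
  \sum_(k < sp_size H)
    (if sp_node H k < t <= sp_node H k.+1 then sp_value H k w else 0).

Definition sp_integral (H : simple_process) (w : path) : R :=
  \sum_(k < sp_size H)
    dot (sp_value H k w) (w (sp_node H k.+1) - w (sp_node H k)).

Variable P : probability path R.

Definition sp_approximates (H : R -> path -> E) (S : nat -> simple_process) :
    Prop :=
  vanish_in_prob P (fun n w =>
    \int[lebesgue_measure]_(t in `[0%R, T])
      (sqnorm (sp_process (S n) t w - H t w))%:E)%E.

(* Ito's construction: I is, up to P-null sets, the limit in probability of the
   elementary integrals of simple adapted processes S n for which
   \int_0^T |S n - H|^2 dt tends to 0 in probability, whatever the choice of
   such a sequence. It is meant for laws P under which the canonical process w
   is an Ito process with constant diffusion coefficient, which makes the limit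
   exist and be independent of the sequence. *)
Definition is_ito_integral (H : R -> path -> E) (I : path -> R) : Prop :=
  [/\ measurable_fun setT I,
      exists S, sp_approximates H S &
      forall S, sp_approximates H S ->
        cvg_in_prob P (fun n => sp_integral (S n)) I].

Definition is_stratonovich_integral (eps : R) (F : R -> E -> E)
    (J : path -> R) : Prop :=
  exists I, is_ito_integral (fun t w => F t (w t)) I /\
    {ae P, forall w, J w = I w +
      eps / 2 * \int[lebesgue_measure]_(t in `[0, T]) div (F t) (w t)}.

End ito_integral.

Section diffusions.
Context {R : realType} (T : R) (d : nat).
Local Notation path := (cpath T d).
Local Notation E := 'rV[R]_d.

Section on_a_probability_space.
Context d0 (Om : measurableType d0) (P : probability Om R).
Implicit Types (F : R -> set (set Om)) (X B : Om -> path).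

Definition is_filtration F : Prop :=
  [/\ forall t, sigma_algebra setT (F t),
      forall t, F t `<=` measurable &
      forall s t, s <= t -> F s `<=` F t].

Definition adapted F X : Prop :=
  forall t i (C : set R), 0 <= t <= T -> measurable C ->
    F t [set o | C (X o t ord0 i)].

(* the product formula states both that the increment is independent of F s
   and that its law is N(0, (t - s) Id) *)
Definition is_brownian F B : Prop :=
  [/\ is_filtration F, adapted F B, {ae P, forall o, B o 0 = 0} &
      forall s t A (C : 'I_d -> set R), 0 <= s -> s < t -> t <= T ->
        F s A -> (forall i, measurable (C i)) ->
        P (A `&` [set o | forall i, C i (B o t ord0 i - B o s ord0 i)]) =
        (P A * \prod_i normal_prob 0 (Num.sqrt (t - s)) (C i))%E].

Definition solves_sde (eps : R) (beta : R -> E -> E) F X B : Prop :=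
  [/\ is_brownian F B, adapted F X &
      {ae P, forall o, forall t i, 0 <= t <= T ->
        X o t ord0 i = X o 0 ord0 i
          + \int[lebesgue_measure]_(s in `[0, t]) (beta s (X o s) ord0 i)
          + Num.sqrt eps * B o t ord0 i}].

End on_a_probability_space.

Definition is_diffusion_law (eps : R) (beta : R -> E -> E)
    (nu : probability path R) : Prop :=
  exists d0 (Om : measurableType d0) (P : probability Om R)
      (F : R -> set (set Om)) (X B : Om -> path),
    solves_sde P eps beta F X B /\
    forall A, measurable A -> nu A = P (X @^-1` A).

Definition is_shifted_brownian_law (eps : R) (x : E)
    (mu : probability path R) : Prop :=
  exists d0 (Om : measurableType d0) (P : probability Om R)
      (F : R -> set (set Om)) (B : Om -> path),
    is_brownian P F B /\
    forall A, measurable A ->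
      mu A = P [set o | A (affine_path x (Num.sqrt eps) (B o))].

Definition is_density (nu : probability path R) (rho : R -> E -> R) : Prop :=
  forall t, 0 <= t <= T -> forall A : set E, measurable A ->
    nu [set w | A (w t)] = (\int[lebesgue_rV d]_(x in A) (rho t x)%:E)%E.

(* x |-> nu_x is a regular version of nu( . | w(0) = x) *)
Definition is_conditional_law (nu : probability path R)
    (nux : E -> probability path R) : Prop :=
  (forall A, measurable A -> measurable_fun [set: E] (nux ^~ A)) /\
  (forall (A : set path) (C : set E), measurable A -> measurable C ->
    nu (A `&` [set w : path | C (w 0)]) =
    (\int[nu]_(w in [set w : path | C (w 0%R)]) nux (w 0%R) A)%E).

Definition girsanov_density (eps : R) (beta : R -> E -> E)
    (nu mu : probability path R) : Prop :=
  exists I, is_ito_integral mu (fun t w => beta t (w t)) I /\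
    {ae mu, forall w,
      Radon_Nikodym (charge_of_finite_measure nu) mu w =
      (expR (eps^-1 * I w - (2 * eps)^-1 *
        \int[lebesgue_measure]_(t in `[0, T]) sqnorm (beta t (w t))))%:E}.

End diffusions.

Section entropy_production.
Context {R : realType} (T : R) (d : nat) (eps : R).
Local Notation path := (cpath T d).
Local Notation E := 'rV[R]_d.
Variables (b : E -> E) (rho : R -> E -> R).

Definition log_grad (t : R) : E -> E := grad (fun x => ln (rho t x)).

Definition current (t : R) (x : E) : E :=
  rho t x *: b x - (eps / 2) *: grad (rho t) x.

Definition velocity (t : R) (x : E) : E := (rho t x)^-1 *: current t x.

Definition fokker_planck : Prop :=
  forall t x, 0 <= t <= T ->
    dt T rho t x =
    - div (fun y => rho t y *: (b y - (eps / 2) *: log_grad t y)) x.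

Definition reversed_drift (t : R) (x : E) : E :=
  - b x + eps *: log_grad (T - t) x.

(* S is a version of s_tot(T) - s_tot(0); the stochastic part of the latter is
   2/eps times the Stratonovich integral of j/rho, taken at time T - t *)
Definition is_total_entropy_production (nu : probability path R)
    (S : path -> R) : Prop :=
  exists J, is_stratonovich_integral nu eps (fun t => velocity (T - t)) J /\
    {ae nu, forall w, S w =
      \int[lebesgue_measure]_(t in `[0, T])
        (dt T rho (T - t) (w t) / rho (T - t) (w t))
      + 2 / eps * J w}.

End entropy_production.

(* Main.v *)
(* Given w(0) = x, the total entropy production is the logarithm of the
   likelihood ratio d nu_x / d nurev_x. The Fokker-Planck equation turns the
   integral of (dt rho / rho + div v) into that of (|beta|^2 - |b|^2) / (2 eps),
   with beta = - b + eps grad log rho the reversed drift, and b = 2 v + beta, so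
   the two Girsanov exponents differ exactly by the entropy production. Hence
   exp (- s_tot) has nu_x-expectation nurev_x(path space) = 1, and s_tot >=
   1 - exp (- s_tot) has nonnegative expectation.

   The Ito integrals of v under nu and of b and beta under mu_x are compared
   without stochastic calculus. Simple processes approximating v under nu do so
   almost surely along a subsequence, a property of null sets that is inherited
   by nu_x for almost every x and by the equivalent measure mu_x. Adding simple
   processes that approximate beta under mu_x gives ones that approximate b. *)

Require Import Defs.
From HB Require Import structures.
From mathcomp Require Import all_boot all_order all_algebra.
From mathcomp Require Import all_classical all_reals all_analysis.
From mathcomp Require Import measurable_realfun.
From mathcomp Require Import ring lra.

Set Implicit Arguments.
Unset Strict Implicit.
Unset Printing Implicit Defensive.

Import Order.TTheory GRing.Theory Num.Theory.
Import numFieldNormedType.Exports.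

Local Open Scope classical_set_scope.
Local Open Scope ring_scope.

(** * Measurability of functions of a state and of a path *)

Section rounding.
Context {R : realType}.

(** The preimage of a measurable set splits into countably many pieces, one per value of [q]. With
    [q] a rounding map, this gives measurability of functions of a rounded argument. *)
Lemma measurable_fun_countable_select d1 (X : measurableType d1)
    d2 (Y : measurableType d2) (Z : countType) (q : X -> Z) (F : Z -> X -> Y) :
  (forall z, measurable (q @^-1` [set z])) ->
  (forall z, measurable_fun setT (F z)) ->
  measurable_fun setT (fun x => F (q x) x).
Proof.
move=> mq mF _ C mC; rewrite setTI.
have -> : (fun x => F (q x) x) @^-1` C =
    \bigcup_z (q @^-1` [set z] `&` F z @^-1` C).
  apply/seteqP; split=> [x Cx|x [z _ [/= <- //]]].
  by exists (q x).
apply: countable_bigcupT_measurable => // z.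
by apply: measurableI => //; rewrite -[_ @^-1` C]setTI; exact: mF.
Qed.

(** The grid index is kept as an integer, so that rounded arguments range over a countable type. *)
Definition round_down (n : nat) (x : R) : int := Num.floor (x * n.+1%:R).

Definition grid_point (n : nat) (z : int) : R := z%:~R / n.+1%:R.

Lemma round_down_near n (x : R) :
  `|x - grid_point n (round_down n x)| <= n.+1%:R^-1.
Proof.
have n0 : 0 < n.+1%:R :> R by rewrite ltr0n.
have /andP[fl fr] := floor_itv (x * n.+1%:R).
rewrite /grid_point /round_down; set z := Num.floor _ in fl fr *.
have h1 : z%:~R / n.+1%:R <= x by rewrite ler_pdivrMr.
rewrite ger0_norm ?subr_ge0// lerBlDr.
rewrite -[X in _ <= X + _]mul1r -mulrDl ler_pdivlMr// ltW// (lt_le_trans fr)//.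
by rewrite intrD addrC.
Qed.

Lemma measurable_round_down n (z : int) :
  measurable (round_down n @^-1` [set z] : set (measurableTypeR R)).
Proof.
have n0 : 0 < n.+1%:R :> R by rewrite ltr0n.
rewrite (_ : _ @^-1` _ =
  `[z%:~R / n.+1%:R, (z + 1)%:~R / n.+1%:R[%classic) //.
apply/seteqP; split => x /=; rewrite in_itv/=.
  by move/eqP; rewrite /round_down floor_eq ler_pdivrMr// ltr_pdivlMr.
by rewrite ler_pdivrMr// ltr_pdivlMr// -floor_eq => /eqP.
Qed.

Lemma cvg_grid_point x : grid_point n (round_down n x) @[n --> \oo] --> x.
Proof.
apply/cvgrPdist_le => e e0.
near=> n; apply: le_trans (round_down_near n x) _.
have : `|0 - harmonic n : R| <= e.
  near: n; move: e e0; apply/(@cvgrPdist_le _ R^o); exact: cvg_harmonic.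
by rewrite /= sub0r normrN ger0_norm.
Unshelve. all: by end_near. Qed.

(** Rounding the time down to a grid of mesh 1/(n+1) leaves countably many times, hence a jointly
    measurable function. Continuity in time gives pointwise convergence as the mesh shrinks. *)
Lemma measurable_fun_caratheodory d (Om : measurableType d) (F : R -> Om -> R) :
  (forall t, measurable_fun setT (F t)) -> (forall o, continuous (F^~ o)) ->
  measurable_fun setT (fun p : measurableTypeR R * Om => F p.1 p.2).
Proof.
move=> mF cF.
apply: (measurable_fun_cvg (h := fun n (p : measurableTypeR R * Om) =>
  F (grid_point n (round_down n p.1)) p.2)).
  move=> n; apply: (measurable_fun_countable_select
    (q := fun p : measurableTypeR R * Om => round_down n p.1)
    (F := fun z (p : measurableTypeR R * Om) => F (grid_point n z) p.2)).
    move=> z; rewrite -[X in measurable X]setTI.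
    exact: (@measurable_fst _ _ (measurableTypeR R) Om measurableT _
              (measurable_round_down n z)).
  by move=> z; exact: (measurableT_comp (mF _) measurable_snd).
move=> [t o] _ /=.
apply: (cvg_comp (fun n => grid_point n (round_down n t)) (F^~ o)
  (@cvg_grid_point t)).
exact: cF.
Qed.

Lemma cvg_rV d (u : nat -> 'rV[R]_d) (x : 'rV[R]_d) :
  (forall i, u n ord0 i @[n --> \oo] --> x ord0 i) -> u n @[n --> \oo] --> x.
Proof.
move=> ux; apply/cvg_ballP => e e0.
suff : \forall n \near \oo, forall i : 'I_d, ball (x ord0 i) e (u n ord0 i).
  by apply: filterS => n h; split => // i j; rewrite (ord1 i); exact: h.
apply: filter_forall => i.
by have /cvg_ballP := ux i; exact.
Qed.

(** The sigma-algebra on row vectors is the one generated by the coordinates, so open sets are not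
    measurable by definition. Rounding every coordinate makes [f] constant on countably many cells,
    each a finite intersection of cylinders, and the rounded functions converge to [f]. *)
Lemma continuous_measurable_rV d (f : 'rV[R]_d -> R) :
  continuous f -> measurable_fun setT f.
Proof.
move=> cf.
pose q n (x : 'rV[R]_d) : 'rV[int]_d := \row_i round_down n (x ord0 i).
pose g n (z : 'rV[int]_d) : 'rV[R]_d := \row_i grid_point n (z ord0 i).
apply: (measurable_fun_cvg (h := fun n x => f (g n (q n x)))).
  move=> n; apply: (measurable_fun_countable_select
     (q := q n) (F := fun z _ => f (g n z))) => // z.
  rewrite (_ : _ @^-1` _ = \bigcap_(i in [set: 'I_d])
      ((fun x : 'rV[R]_d => x ord0 i) @^-1` (round_down n @^-1` [set z ord0 i]))).
    apply: fin_bigcap_measurable => // i _.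
    rewrite -[X in measurable X]setTI.
    exact: (measurable_coord _ measurableT (measurable_round_down n _)).
  apply/seteqP; split => x /=.
    by move=> <- i _ /=; rewrite mxE.
  by move=> h; apply/rowP => i; rewrite mxE; exact: h.
move=> x _; apply: (cvg_comp (fun n => g n (q n x)) f _ (cf x)).
apply: cvg_rV => i; rewrite (_ : (fun _ => _) =
   fun n => grid_point n (round_down n (x ord0 i))); last first.
  by apply/funext => n; rewrite !mxE.
exact: cvg_grid_point.
Qed.

End rounding.

(** * Linear combinations of simple processes *)

Section simple_processes.
Context {R : realType} {T : R} {d : nat}.
Local Notation path := (cpath T d).
Implicit Types (H K L : simple_process T d).

(* Each summand equals the increment of [f] along [tau] clamped between
   [tau p] and [tau q], so the sum telescopes. *)
Lemma telescope_between (f : R -> R) (tau : nat -> R) (m p q : nat) :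
  (forall i j, (i <= j <= m)%N -> tau i <= tau j) ->
  (p <= m)%N -> (q <= m)%N -> tau p <= tau q ->
  \sum_(j < m) (if tau p < tau j.+1 <= tau q
                then f (tau j.+1) - f (tau j) else 0) = f (tau q) - f (tau p).
Proof.
move=> mono pm qm pq.
pose g t := f (Num.max (tau p) (Num.min t (tau q))).
transitivity (\sum_(0 <= j < m) (g (tau j.+1) - g (tau j))).
  rewrite big_mkord; apply: eq_bigr => j _.
  have jm : (j < m)%N := ltn_ord j.
  have jj : tau j <= tau j.+1 by apply: (mono); rewrite leqnSn.
  rewrite /g; have [jp|pj] := leP (tau j.+1) (tau p) => /=.
    rewrite (@min_l _ _ (tau j.+1)) ?(le_trans jp)//.
    rewrite (@min_l _ _ (tau j)) ?(le_trans jj) ?(le_trans jp)//.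
    by rewrite !max_l ?subrr// (le_trans jj).
  (* Nodes may coincide, so indices are compared by contradiction: [j < p] would give
     [tau j.+1 <= tau p]. *)
  have pj' : tau p <= tau j.
    apply: (mono); rewrite (ltnW jm) andbT leqNgt; apply/negP => jp.
    by move: pj; rewrite ltNge mono// jp pm.
  have [jq|qj] := leP (tau j.+1) (tau q).
    by rewrite min_l ?(le_trans jj)// !max_r// ltW.
  have qj' : tau q <= tau j.
    apply: (mono); rewrite (ltnW jm) andbT leqNgt; apply/negP => qj'.
    by move: qj; rewrite ltNge mono// qj' qm.
  by rewrite !min_r// subrr.
rewrite telescope_sumr// /g.
have -> : Num.min (tau m) (tau q) = tau q.
  by rewrite min_r// mono// qm leqnn.
have h0 : tau 0 <= tau p by apply: mono.
by rewrite min_l ?(le_trans h0)// max_r// max_l.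
Qed.

Lemma sp_node_itv H k : (k <= sp_size H)%N -> 0 <= sp_node H k <= T.
Proof.
have h n a : (a + n <= sp_size H)%N -> sp_node H a <= sp_node H (a + n)%N.
  elim: n => [_|n IH]; first by rewrite addn0.
  rewrite addnS => an; rewrite (le_trans (IH (ltnW an)))//.
  exact: sp_node_le.
move=> kH; have := h k 0%N; rewrite add0n sp_node0 => -> //=.
by have := h (sp_size H - k)%N k; rewrite subnKC// sp_nodeT => ->.
Qed.

(* Taking [f] to be a coordinate of the path gives the elementary integral;
   [f := fun u => (t <= u)] gives the value of the process at time [t]. *)
Definition sp_sum H (f : R -> R) (w : path) (i : 'I_d) : R :=
  \sum_(k < sp_size H) sp_value H k w ord0 i *
    (f (sp_node H k.+1) - f (sp_node H k)).

Lemma sp_process_coord H t w i : sp_process H t w ord0 i =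
  \sum_(k < sp_size H) (if sp_node H k < t <= sp_node H k.+1
                        then sp_value H k w ord0 i else 0).
Proof.
by rewrite /sp_process summxE; apply: eq_bigr => k _; case: ifP; rewrite ?mxE.
Qed.

(** The indicator of (a, b] at t is the increment from a to b of the step function that jumps from 0
    to 1 at t. *)
Lemma sp_process_sum H t w i :
  sp_process H t w ord0 i = sp_sum H (fun u => (t <= u)%R%:R) w i.
Proof.
rewrite sp_process_coord; apply: eq_bigr => k _.
have := sp_node_le (ltn_ord k); set a := sp_node H k; set b := sp_node H k.+1.
move=> ab; have [ta|at_] := leP t a => /=.
  by rewrite (le_trans ta ab) subrr mulr0.
by case: ifP => _; rewrite subr0 ?mulr1 ?mulr0.
Qed.

Lemma sp_integral_sum H w :
  sp_integral H w = \sum_i sp_sum H (fun u => w u ord0 i) w i.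
Proof.
rewrite /sp_integral /sp_sum exchange_big /=; apply: eq_bigr => k _.
by apply: eq_bigr => i _; rewrite !mxE.
Qed.

Section refinement.
Variables (H : simple_process T d) (tau : nat -> R) (m : nat).
Hypothesis mono : forall i j, (i <= j <= m)%N -> tau i <= tau j.
Hypothesis refines : forall k, (k <= sp_size H)%N ->
  exists2 p, (p <= m)%N & tau p = sp_node H k.

(** After exchanging the sums, the increments of [f] over the fine intervals inside one interval of
    [H] telescope. *)
Lemma sp_sum_refine f w i :
  \sum_(j < m) sp_process H (tau j.+1) w ord0 i * (f (tau j.+1) - f (tau j)) =
  sp_sum H f w i.
Proof.
under eq_bigr do rewrite sp_process_coord mulr_suml.
rewrite exchange_big /=; apply: eq_bigr => k _.
have [p pm tp] := refines (ltnW (ltn_ord k)).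
have [q qm tq] := refines (ltn_ord k).
rewrite -tp -tq -(telescope_between f mono pm qm); last first.
  by rewrite tp tq sp_node_le.
rewrite mulr_sumr; apply: eq_bigr => j _.
by case: ifP; rewrite ?mul0r ?mulr0.
Qed.

(** An interval of [H] that contains [tau k.+1] starts at a node of [tau] strictly before it, hence
    no later than [tau k]; its coefficient is therefore known at time [tau k]. *)
Lemma sp_process_refine_adapted k i : (k < m)%N ->
  measurable_fun [set: g_sigma_algebraType (@cpath_cylinder R T d `[0, tau k])]
    (fun w => sp_process H (tau k.+1) w ord0 i).
Proof.
move=> km; rewrite (funext (fun w => sp_process_coord H (tau k.+1) w i)).
apply: measurable_sum => j.
case: (boolP (sp_node H j < tau k.+1 <= sp_node H j.+1)) => // /andP[jk _].
move=> _ C mC; rewrite setTI.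
have [p pm tp] := refines (ltnW (ltn_ord j)).
have jk' : sp_node H j <= tau k.
  rewrite -tp; apply: (mono); rewrite (ltnW km) andbT leqNgt; apply/negP => kp.
  by move: jk; rewrite -tp ltNge mono// kp pm.
have := @sp_adapted _ _ _ H j i C (ltn_ord j) mC.
apply: sub_sigma_algebra2 => A [t [i' [C' [tI mC' ->]]]].
exists t, i', C'; split => //.
by move: tI; rewrite /= !in_itv/= => /andP[-> /le_trans]; exact.
Qed.

End refinement.

(** Both processes are rewritten on the sorted union of their nodes, where they can be combined
    interval by interval. *)
Lemma simple_process_comb (c : R) H K : exists L,
  (forall t w, sp_process L t w = c *: sp_process H t w + sp_process K t w) /\
  (forall w, sp_integral L w = c * sp_integral H w + sp_integral K w).
Proof.
pose nodes (G : simple_process T d) := mkseq (sp_node G) (sp_size G).+1.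
pose s := sort <=%O (nodes H ++ nodes K).
pose m := (size s).-1; pose tau := nth 0 s.
have sE : (size s = m.+1)%N by rewrite /m /s size_sort size_cat size_mkseq.
have mono i j : (i <= j <= m)%N -> tau i <= tau j.
  move=> /andP[ij jm]; apply: (sorted_leq_nth le_trans lexx) => //.
  - exact: sort_le_sorted.
  - by rewrite inE sE ltnS (leq_trans ij).
  - by rewrite inE sE ltnS.
have mem x : x \in s -> exists2 p, (p <= m)%N & tau p = x.
  by move=> xs; exists (index x s); [rewrite -ltnS -sE index_mem|exact: nth_index].
have refH k : (k <= sp_size H)%N -> exists2 p, (p <= m)%N & tau p = sp_node H k.
  move=> kH; apply: mem; rewrite mem_sort mem_cat; apply/orP; left.
  by apply/mapP; exists k => //; rewrite mem_iota.
have refK k : (k <= sp_size K)%N -> exists2 p, (p <= m)%N & tau p = sp_node K k.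
  move=> kK; apply: mem; rewrite mem_sort mem_cat; apply/orP; right.
  by apply/mapP; exists k => //; rewrite mem_iota.
have tau_itv p : (p <= m)%N -> 0 <= tau p <= T.
  move=> pm; have : tau p \in s by rewrite mem_nth// sE ltnS.
  rewrite mem_sort mem_cat => /orP[|] /mapP[k];
    by rewrite mem_iota => /andP[_ kG] ->; apply: sp_node_itv.
(* All nodes lie in [0, T] and 0 is one of them, so the first of the sorted nodes is 0; in the same
   way the last one is [T]. *)
have tau0 : tau 0%N = 0.
  have [p pm tp] := refH 0%N (leq0n _).
  apply/eqP; rewrite eq_le (andP (tau_itv _ (leq0n _))).1 andbT.
  by rewrite -[leRHS](sp_node0 H) -tp mono.
have taum : tau m = T.
  have [p pm tp] := refH _ (leqnn _).
  apply/eqP; rewrite eq_le (andP (tau_itv _ (leqnn _))).2 /=.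
  by rewrite -[leLHS](sp_nodeT H) -tp mono// pm leqnn.
have le_tau k : (k < m)%N -> tau k <= tau k.+1.
  by move=> km; apply: (mono); rewrite leqnSn.
(* On a refinement, the value on (tau k, tau (k+1)] can be read off at the right
   endpoint and is already known at time tau k. *)
pose v k w := c *: sp_process H (tau k.+1) w + sp_process K (tau k.+1) w.
have v_adapted k i (C : set R) : (k < m)%N -> measurable C ->
    @natural_filtration R T d (tau k) [set w | C (v k w ord0 i)].
  move=> km mC.
  have : measurable_fun
      [set: g_sigma_algebraType (@cpath_cylinder R T d `[0, tau k])]
      (fun w => v k w ord0 i).
    rewrite (_ : (fun w => _) = fun w => c * sp_process H (tau k.+1) w ord0 i +
      sp_process K (tau k.+1) w ord0 i); last first.
      by apply/funext => w; rewrite !mxE.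
    apply: measurable_funD; last exact: (sp_process_refine_adapted mono refK).
    by apply: measurable_funM => //; exact: (sp_process_refine_adapted mono refH).
  by move=> /(_ measurableT C mC); rewrite setTI.
exists (SimpleProcess tau0 taum le_tau v_adapted).
set L := SimpleProcess _ _ _ _.
(* One identity, for arbitrary [f], yields both the values and the elementary integrals. *)
have sumE f w i : sp_sum L f w i = c * sp_sum H f w i + sp_sum K f w i.
  rewrite -(sp_sum_refine mono refH) -(sp_sum_refine mono refK).
  rewrite mulr_sumr -big_split /=; apply: eq_bigr => j _.
  by rewrite /v !mxE mulrDl mulrA.
split=> [t w|w].
  by apply/rowP => i; rewrite !mxE !sp_process_sum sumE.
rewrite !sp_integral_sum mulr_sumr -big_split /=.
by apply: eq_bigr => i _.
Qed.

End simple_processes.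

(** * Convergence in probability *)

Section convergence_in_probability.
Context {R : realType}.
Local Open Scope ereal_scope.

Lemma cvge0P (u : nat -> \bar R) : (forall n, 0 <= u n) ->
  (u n @[n --> \oo] --> 0) <->
  (forall e : R, (0 < e)%R -> \forall n \near \oo, u n <= e%:E).
Proof.
move=> u0; split=> [/fine_cvgP[fu cu] e e0|h].
  have /(@cvgrPdist_le _ R^o) /(_ _ e0) cue := cu.
  apply: filterS2 fu cue => n fun_ /=.
  rewrite sub0r normrN ger0_norm ?fine_ge0// => une.
  by rewrite -(fineK fun_) lee_fin.
have fu : \forall n \near \oo, u n \is a fin_num.
  apply: filterS (h 1%R ltr01) => n un1.
  by rewrite ge0_fin_numE// (le_lt_trans un1)// ltry.
apply/fine_cvgP; split => //.
apply/(@cvgrPdist_le _ R^o) => e e0.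
apply: filterS2 fu (h e e0) => n fun_ une /=.
by rewrite sub0r normrN ger0_norm ?fine_ge0// -lee_fin fineK.
Qed.

Context d (Om : measurableType d).
Implicit Types (P : probability Om R) (Y Z W : nat -> Om -> \bar R).

(** The threshold shrinks with the index: outside the limit superior of these sets, [Y n] tends to 0
    with |Y n| eventually below 1/(n+1). *)
Definition exceedance Y (n : nat) : set Om :=
  [set o | (n.+1%:R^-1)%:E <= `|Y n o|].

Lemma measurable_level (f : Om -> \bar R) (a : R) :
  measurable_fun setT f -> measurable [set o | a%:E <= `|f o|].
Proof.
move=> mf; rewrite -[X in measurable X]setTI; apply: measurable_lee => //.
exact: measurableT_comp.
Qed.

Lemma vanish_in_probP P Y : vanish_in_prob P Y <->
  forall delta e : R, (0 < delta)%R -> (0 < e)%R ->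
    \forall n \near \oo, P [set o | delta%:E <= `|Y n o|] <= e%:E.
Proof.
split=> [vY delta e delta0 e0|vY delta delta0].
  have /cvge0P := vY _ delta0; apply => // n; exact: measure_ge0.
by apply/cvge0P => [n|e e0]; [exact: measure_ge0|exact: vY].
Qed.

(* Sequences that are almost surely below 1/(n+1) eventually: a condition on null
   sets only, hence it passes to conditional laws and to equivalent measures. *)
Lemma vanish_in_prob_select P Y Z :
  (forall n, measurable_fun setT (Y n)) ->
  (forall n, measurable_fun setT (Z n)) ->
  vanish_in_prob P Y -> vanish_in_prob P Z ->
  exists phi : nat -> nat,
    P (lim_sup_set (exceedance (Y \o phi))) = 0 /\
    P (lim_sup_set (exceedance (Z \o phi))) = 0.
Proof.
move=> mY mZ /vanish_in_probP vY /vanish_in_probP vZ.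
(* The bounds are summable, with sum 1, as Borel-Cantelli requires. A common index is chosen because
   the same simple processes must serve for the integrand and for the integral. *)
have ex n : exists m,
    P [set o | (n.+1%:R^-1)%:E <= `|Y m o|] <= (1 / (2 ^ n.+1)%:R)%:E /\
    P [set o | (n.+1%:R^-1)%:E <= `|Z m o|] <= (1 / (2 ^ n.+1)%:R)%:E.
  have n0 : (0 < n.+1%:R^-1 :> R)%R by rewrite invr_gt0 ltr0n.
  have e0 : (0 < 1 / (2 ^ n.+1)%:R :> R)%R by rewrite divr_gt0// ltr0n expn_gt0.
  have hY := vY _ _ n0 e0; have hZ := vZ _ _ n0 e0.
  have /filter_ex[m [mY' mZ']] : \forall m \near \oo,
      P [set o | (n.+1%:R^-1)%:E <= `|Y m o|] <= (1 / (2 ^ n.+1)%:R)%:E /\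
      P [set o | (n.+1%:R^-1)%:E <= `|Z m o|] <= (1 / (2 ^ n.+1)%:R)%:E.
    by apply: filterS2 hY hZ.
  by exists m.
have [phi hphi] := choice ex; exists phi.
have null W : (forall n, measurable_fun setT (W n)) ->
    (forall n, P [set o | (n.+1%:R^-1)%:E <= `|W (phi n) o|]
      <= (1 / (2 ^ n.+1)%:R)%:E) ->
    P (lim_sup_set (exceedance (W \o phi))) = 0.
  move=> mW hW; apply: lim_sup_set_cvg0 => [n|].
    by apply: measurable_level; exact: mW.
  apply: (@le_lt_trans _ _ 1%:E); last exact: ltry.
  apply: le_trans (epsilon_trick0 xpredT (@ler01 R)).
  by apply: lee_nneseries => // n _; exact: hW.
by split; apply: null => // n; have [] := hphi n.
Qed.

(** By continuity from above, the tail unions have probability tending to 0, and once 1/(n+1) <=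
    delta the event |Y n| >= delta lies in the tail union from [n] on. *)
Lemma lim_sup_exceedance_vanish P Y : (forall n, measurable_fun setT (Y n)) ->
  P (lim_sup_set (exceedance Y)) = 0 -> vanish_in_prob P Y.
Proof.
move=> mY Y0; apply/vanish_in_probP => delta e delta0 e0.
have mE n : measurable (exceedance Y n) by apply: measurable_level; exact: mY.
have mU n : measurable (\bigcup_(k in [set k | (n <= k)%N]) exceedance Y k).
  by apply: bigcup_measurable => k _.
have Ploo : P (\bigcup_(k in [set k | (0 <= k)%N]) exceedance Y k) < +oo.
  by rewrite (le_lt_trans (probability_le1 P (mU 0%N)))// ltry.
have /cvge0P near_e :
    P (\bigcup_(k in [set k | (n <= k)%N]) exceedance Y k) @[n --> \oo] --> 0.
  by rewrite -Y0; exact: lim_sup_set_cvg.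
have {}near_e := near_e (fun=> measure_ge0 _ _) _ e0.
have near_d : \forall n \near \oo, (n.+1%:R^-1 <= delta)%R.
  have /(@cvgrPdist_le _ R^o) /(_ _ delta0) := @cvg_harmonic R.
  by apply: filterS => n /=; rewrite sub0r normrN ger0_norm.
apply: filterS2 near_e near_d => n ne nd; apply: le_trans ne.
apply: le_measure; rewrite ?inE//; first exact: measurable_level.
move=> o /= od; exists n => //=; apply: le_trans od.
by rewrite lee_fin.
Qed.

(** If |W n| >= delta, then |Y n| or |Z n| is at least delta / (2c); each of the two events gets
    half of the error. *)
Lemma vanish_in_prob_dom P Y Z W (c : R) : (0 < c)%R ->
  (forall n, measurable_fun setT (Y n)) ->
  (forall n, measurable_fun setT (Z n)) ->
  (forall n, measurable_fun setT (W n)) ->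
  (forall n o, `|W n o| <= c%:E * (`|Y n o| + `|Z n o|)) ->
  vanish_in_prob P Y -> vanish_in_prob P Z -> vanish_in_prob P W.
Proof.
move=> c0 mY mZ mW WYZ /vanish_in_probP vY /vanish_in_probP vZ.
apply/vanish_in_probP => delta e delta0 e0.
have d0 : (0 < delta / (2 * c))%R by rewrite divr_gt0// mulr_gt0.
have e2 : (0 < e / 2)%R by rewrite divr_gt0.
apply: filterS2 (vY _ _ d0 e2) (vZ _ _ d0 e2) => n hY hZ.
have -> : e%:E = (e / 2)%:E + (e / 2)%:E by rewrite -EFinD -splitr.
apply: le_trans (leeD hY hZ).
apply: le_trans (measureU2 _ _ _); try exact: measurable_level.
apply: le_measure; rewrite ?inE.
- exact: measurable_level.
- by apply: measurableU; exact: measurable_level.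
move=> o /= dW.
have [?|Yd] := leP (delta / (2 * c))%:E `|Y n o|; first by left.
have [?|Zd] := leP (delta / (2 * c))%:E `|Z n o|; first by right.
exfalso; have := le_trans dW (WYZ n o); apply/negP; rewrite -ltNge.
have -> : delta%:E = c%:E * ((delta / (2 * c))%:E + (delta / (2 * c))%:E).
  by rewrite -EFinD -EFinM; congr EFin; field; rewrite gt_eqF.
by rewrite lte_pmul2l// lteD.
Qed.

(** Applied to the difference of two limits, this is the almost sure uniqueness of limits in
    probability. *)
Lemma vanish_in_prob_cst P (D : Om -> R) : measurable_fun setT D ->
  vanish_in_prob P (fun _ => EFin \o D) -> {ae P, forall o, D o = 0%R}.
Proof.
move=> mD vD.
have mlev a : measurable [set o | a%:E <= `|(D o)%:E|].
  by apply: measurable_level; exact/measurable_EFinP.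
have h n : P [set o | (n.+1%:R^-1)%:E <= `|(D o)%:E|] = 0.
  have n0 : (0 < n.+1%:R^-1 :> R)%R by rewrite invr_gt0 ltr0n.
  by have /cvg_lim <- // := vD _ n0; rewrite lim_cst.
apply: (@negligibleS _ _ _ P
    (\bigcup_n [set o | (n.+1%:R^-1)%:E <= `|(D o)%:E|])); last first.
  by apply: negligible_bigcup => n; apply/negligibleP; [exact: mlev|exact: h].
move=> o /= /eqP D0.
have Dpos : (0 < `|D o|)%R by rewrite normr_gt0.
have /(@cvgrPdist_le _ R^o) /(_ _ Dpos) /filter_ex[n /=] := @cvg_harmonic R.
by rewrite sub0r normrN ger0_norm// => nD; exists n.
Qed.

End convergence_in_probability.

(** * Linearity of the Ito integral *)

Section ito_linearity.
Context {R : realType} {T : R} {d : nat}.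
Hypothesis T_ge0 : 0 <= T.
Local Notation path := (cpath T d).
Local Notation E := 'rV[R]_d.

(** Joint measurability in time and path, so that by Tonelli time integrals of squared distances are
    random variables. *)
Definition measurable_process (H : R -> path -> E) : Prop :=
  forall i, measurable_fun
    (`[0, T]%classic `*` [set: path] : set (measurableTypeR R * path))
    (fun p => H p.1 p.2 ord0 i).

Lemma measurable_sp_value (S : simple_process T d) k i : (k < sp_size S)%N ->
  measurable_fun setT (fun w => sp_value S k w ord0 i).
Proof.
move=> kS _ C mC; rewrite setTI.
apply: sub_sigma_algebra2 (sp_adapted i kS mC) => A [t [j [C' [tI mC' ->]]]].
have /andP[_ kT] := sp_node_itv (ltnW kS).
exists t, j, C'; split => //; move: tI; rewrite /= !in_itv/= => /andP[-> /=].
by move/le_trans; exact.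
Qed.

Lemma measurable_sp_integral (S : simple_process T d) :
  measurable_fun setT (sp_integral S).
Proof.
rewrite /sp_integral; apply: measurable_sum => k; apply: measurable_sum => i.
apply: measurable_funM; first exact: measurable_sp_value.
rewrite (_ : (fun _ => _) = fun w : path =>
  w (sp_node S k.+1) ord0 i - w (sp_node S k) ord0 i); last first.
  by apply/funext => w; rewrite !mxE.
by apply: measurable_funB; exact: measurable_eval.
Qed.

Lemma measurable_process_sp (S : simple_process T d) :
  measurable_process (sp_process S).
Proof.
move=> i; apply: measurable_funTS.
rewrite (_ : (fun _ => _) = fun p : measurableTypeR R * path =>
  \sum_(k < sp_size S) \1_(`]sp_node S k, sp_node S k.+1]%classic) p.1 *
    sp_value S k p.2 ord0 i); last first.
  apply/funext => p; rewrite sp_process_coord; apply: eq_bigr => k _.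
  rewrite indicE mem_setE in_itv /=.
  by case: ifP; rewrite ?mul1r ?mul0r.
apply: measurable_sum => k; apply: measurable_funM.
  exact: (measurableT_comp (measurable_indic _) measurable_fst).
apply: (measurableT_comp (f := fun w => sp_value S k w ord0 i)) => //.
exact: measurable_sp_value.
Qed.

Definition sqdist (G H : R -> path -> E) (t : R) (w : path) : \bar R :=
  (sqnorm (G t w - H t w))%:E.

Lemma sqnorm_ge0 (x : E) : 0 <= sqnorm x.
Proof. by apply: sumr_ge0 => i _; exact: sqr_ge0. Qed.

Lemma measurable_sqdist G H : measurable_process G -> measurable_process H ->
  measurable_fun
    (`[0, T]%classic `*` [set: path] : set (measurableTypeR R * path))
    (fun p => sqdist G H p.1 p.2).
Proof.
move=> mG mH; apply/measurable_EFinP; apply: measurable_sum => i.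
rewrite (_ : (fun _ => _) = fun p : measurableTypeR R * path =>
  (G p.1 p.2 ord0 i - H p.1 p.2 ord0 i) ^+ 2); last first.
  by apply/funext => p; rewrite !mxE.
apply: (@measurable_funX _ _ _ _
  (fun p : measurableTypeR R * path => G p.1 p.2 ord0 i - H p.1 p.2 ord0 i)).
exact: measurable_funB.
Qed.

Let mdom : measurable
  (`[0, T]%classic `*` [set: path] : set (measurableTypeR R * path)).
Proof. by apply: measurableX. Qed.

Lemma measurable_integral_process (f : R -> path -> \bar R) :
  (forall t w, (0 <= f t w)%E) ->
  measurable_fun
    (`[0, T]%classic `*` [set: path] : set (measurableTypeR R * path))
    (fun p => f p.1 p.2) ->
  measurable_fun setT (fun w => \int[lebesgue_measure]_(t in `[0%R, T]) f t w)%E.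
Proof.
move=> f0 mf.
pose F := (fun p : measurableTypeR R * path => f p.1 p.2) \_
  (`[0, T]%classic `*` [set: path]).
have mF : measurable_fun setT F.
  by apply/(measurable_restrict _ mdom measurableT); rewrite setTI.
have F0 p : (0 <= F p)%E by rewrite /F /patch; case: ifP.
have := @measurable_fun_fubini_tonelli_G _ _ _ _ _ lebesgue_measure F mF F0.
congr measurable_fun; apply/funext => w.
rewrite /fubini_G [RHS]integral_mkcond; apply: eq_integral => t _.
rewrite /F /patch; congr (if _ then _ else _).
by apply/idP/idP; rewrite !inE/=; [case|].
Qed.

Lemma measurable_process_section (f : R -> path -> \bar R) w :
  measurable_fun
    (`[0, T]%classic `*` [set: path] : set (measurableTypeR R * path))
    (fun p => f p.1 p.2) ->
  measurable_fun (`[0, T]%classic : set (measurableTypeR R)) (f ^~ w).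
Proof.
move=> mf; apply: (measurable_comp mdom _ mf (g := fun t => (t, w))).
  by move=> _ [t t0T <-].
by apply: measurable_funTS; exact: measurable_pair2.
Qed.

(** In each coordinate (cx + y)^2 <= 2 c^2 x^2 + 2 y^2, because (cx - y)^2 >= 0. *)
Lemma sqnorm_comb (c : R) (x y : E) :
  sqnorm (c *: x + y) <= (2 * (c ^+ 2 + 1)) * (sqnorm x + sqnorm y).
Proof.
rewrite /sqnorm -big_split mulr_sumr; apply: ler_sum => i _ /=; rewrite !mxE.
have := sqr_ge0 (c * x ord0 i - y ord0 i).
have := sqr_ge0 (x ord0 i); have := sqr_ge0 (c * y ord0 i).
by nra.
Qed.

Section combination.
Variables (P : probability path R) (c : R).
Variables (F G V : R -> path -> E) (IF IG IV : path -> R).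
Hypotheses (mV : measurable_process V) (mG : measurable_process G).
Hypothesis FGV : forall t w, 0 <= t <= T -> F t w = c *: V t w + G t w.

(** The error of [L n] is [c] times that of [S n] plus that of [K n], so its squared norm,
    integrated over [0, T], is dominated by the other two. *)
Lemma sp_approximates_comb (S K L : nat -> simple_process T d) :
  (forall n t w,
    sp_process (L n) t w = c *: sp_process (S n) t w + sp_process (K n) t w) ->
  sp_approximates P V S -> sp_approximates P G K -> sp_approximates P F L.
Proof.
move=> LSK; pose C := 2 * (c ^+ 2 + 1).
have C0 : 0 < C by rewrite mulr_gt0// ltr_wpDl ?sqr_ge0.
have mF : measurable_process F.
  move=> i; apply: (eq_measurable_fun (fun p : measurableTypeR R * path =>
      c * V p.1 p.2 ord0 i + G p.1 p.2 ord0 i)).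
    move=> p; rewrite inE/= => -[pT _].
    by rewrite FGV ?mxE//; move: pT; rewrite in_itv.
  apply: measurable_funD; last exact: mG.
  by apply: measurable_funM => //; exact: mV.
have mS H : measurable_process H -> forall A : simple_process T d,
    measurable_fun (`[0, T]%classic `*` [set: path] : set (measurableTypeR R * path))
      (fun p => sqdist (sp_process A) H p.1 p.2).
  by move=> mH A; apply: measurable_sqdist => //; exact: measurable_process_sp.
have sq0 H A t w : (0 <= sqdist A H t w)%E by rewrite lee_fin sqnorm_ge0.
apply: (vanish_in_prob_dom C0).
- by move=> n; exact: (measurable_integral_process (sq0 _ _) (mS _ mV (S n))).
- by move=> n; exact: (measurable_integral_process (sq0 _ _) (mS _ mG (K n))).
- by move=> n; exact: (measurable_integral_process (sq0 _ _) (mS _ mF (L n))).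
move=> n w.
rewrite !gee0_abs; try by apply: integral_ge0 => t _; rewrite lee_fin sqnorm_ge0.
have mSV := measurable_process_section w (mS _ mV (S n)).
have mKG := measurable_process_section w (mS _ mG (K n)).
have mLF := measurable_process_section w (mS _ mF (L n)).
rewrite -ge0_integralD//=; last 2 first.
- by move=> t _; rewrite lee_fin sqnorm_ge0.
- by move=> t _; rewrite lee_fin sqnorm_ge0.
rewrite -ge0_integralZl//=; last 3 first.
- exact: emeasurable_funD mSV mKG.
- by move=> t _; rewrite adde_ge0// lee_fin sqnorm_ge0.
- exact: ltW.
apply: ge0_le_integral => //=.
- by move=> t _; rewrite lee_fin sqnorm_ge0.
- by apply: measurable_funeM; exact: emeasurable_funD mSV mKG.
move=> t tT; rewrite -EFinD -EFinM lee_fin.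
rewrite FGV ?LSK; last by move: tT; rewrite in_itv.
rewrite opprD addrACA -scalerBr; exact: sqnorm_comb.
Qed.

(** The combined simple processes approximate [F], so their elementary integrals tend both to [IF]
    and to [c * IV + IG]. For [V] the data are a single sequence with convergent integrals, which is
    what can be carried over from another measure. *)
Lemma ito_integral_comb (S : nat -> simple_process T d) :
  measurable_fun setT IV -> sp_approximates P V S ->
  cvg_in_prob P (fun n => sp_integral (S n)) IV ->
  is_ito_integral P G IG -> is_ito_integral P F IF ->
  {ae P, forall w, IF w = c * IV w + IG w}.
Proof.
move=> mIV SV SIV [mIG [K KG] cvgG] [mIF _ cvgF].
have [L LSK] := choice (fun n => simple_process_comb c (S n) (K n)).
have LF := sp_approximates_comb (fun n => (LSK n).1) SV KG.
have mdiff (I : path -> R) (A : nat -> simple_process T d) :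
    measurable_fun setT I -> forall n, measurable_fun setT
      (fun w => (sp_integral (A n) w - I w)%:E).
  move=> mI n; apply/measurable_EFinP; apply: measurable_funB => //.
  exact: measurable_sp_integral.
pose Y n w : \bar R := (c * (sp_integral (S n) w - IV w) +
   (sp_integral (K n) w - IG w))%:E.
have mY n : measurable_fun setT (Y n).
  apply/measurable_EFinP; apply: measurable_funD; last first.
    by apply/measurable_EFinP; exact: mdiff.
  apply: measurable_funM => //; apply/measurable_EFinP; exact: mdiff.
(* Adding 1 gives a positive constant that also bounds the coefficient 1 of the second term. *)
have c0 : 0 < `|c| + 1 by rewrite ltr_wpDl.
have vY : vanish_in_prob P Y.
  apply: (vanish_in_prob_dom c0 (mdiff _ S mIV) (mdiff _ K mIG) mY) => //.
  - move=> n w; rewrite /Y -EFinD -EFinM lee_fin.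
    apply: le_trans (ler_normD _ _) _; rewrite normrM.
    have := normr_ge0 (sp_integral (S n) w - IV w).
    have := normr_ge0 (sp_integral (K n) w - IG w).
    have := normr_ge0 c.
    by nra.
  - exact: cvgG.
suff : {ae P, forall w, IF w - (c * IV w + IG w) = 0}.
  by apply: filterS => w /eqP; rewrite subr_eq0 => /eqP.
apply: vanish_in_prob_cst.
  apply: measurable_funB => //; apply: measurable_funD => //.
  exact: measurable_funM.
apply: (vanish_in_prob_dom ltr01 mY (mdiff _ L mIF)) => //.
- move=> _; apply/measurable_EFinP; apply: measurable_funB => //.
  by apply: measurable_funD => //; exact: measurable_funM.
- move=> n w; rewrite mul1e -EFinD lee_fin /Y (LSK n).2.
  set a := sp_integral _ w; set b := sp_integral _ w.
  have -> : IF w - (c * IV w + IG w) =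
    (c * (a - IV w) + (b - IG w)) - (c * a + b - IF w) by ring.
  exact: ler_normB.
- exact: cvgF.
Qed.

End combination.
End ito_linearity.

(** * The Fokker-Planck equation *)

Section fokker_planck_identity.
Context {R : realType} {d : nat}.
Local Notation E := 'rV[R]_d.

(** Reduces a directional derivative to one real variable, where the chain rule for [ln] applies. *)
Lemma derive_line (f : E -> R) (x v : E) :
  'D_v f x = (fun h : R => f (h *: v + x))^`()%classic 0.
Proof.
rewrite /derive /derive1; set p := (fun _ : R => _); set q := (fun _ : R => _).
suff -> : p = q by [].
by apply/funext => h; rewrite /p /q /shift/= addr0 scale0r add0r.
Qed.

Lemma derive_ln (f : E -> R) (x v : E) : 0 < f x -> derivable f x v ->
  'D_v (fun y => ln (f y)) x = 'D_v f x / f x.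
Proof.
move=> fx0 dfx; rewrite 2!derive_line.
have h0 : f (0 *: v + x) = f x by rewrite scale0r add0r.
have [dl el] : is_derive (f (0 *: v + x)) 1 (@ln R) (f x)^-1.
  by rewrite h0; exact: is_derive1_ln.
rewrite (_ : (fun h => _) = @ln R \o (fun h : R => f (h *: v + x)))//.
rewrite derive1_comp; [|exact/(derivable1P f x v).1|exact: dl].
by rewrite [X in X * _]derive1E el mulrC.
Qed.

Variables (T eps : R) (b : E -> E) (rho : R -> E -> R).
Hypothesis eps_gt0 : 0 < eps.
Hypothesis b_C1 : C1_field b.
Hypothesis rho_gt0 : forall t x, 0 <= t <= T -> 0 < rho t x.
Hypothesis rho_C12 : C12 T rho.
Hypothesis rho_FP : fokker_planck T eps b rho.

Lemma log_gradE t x i : 0 <= t <= T ->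
  log_grad rho t x ord0 i = partial i (rho t) x / rho t x.
Proof.
move=> tT; rewrite mxE /partial derive_ln//; first exact: rho_gt0.
by case: rho_C12 => _ + _ _; exact.
Qed.

Lemma velocityE t : 0 <= t <= T ->
  velocity eps b rho t = fun y => b y - (eps / 2) *: log_grad rho t y.
Proof.
move=> tT; apply/funext => y; apply/rowP => i.
have := log_gradE y i tT; rewrite /velocity /current !mxE => ->.
by have := rho_gt0 y tT => r0; field; rewrite gt_eqF.
Qed.

Lemma derivable_velocity t x i : 0 <= t <= T ->
  derivable (fun y => velocity eps b rho t y ord0 i) x (delta_mx ord0 i).
Proof.
move=> tT; rewrite velocityE//.
rewrite (_ : (fun y => _) = (fun y => b y ord0 i) -
    (eps / 2) \*: (fun y => partial i (rho t) y / rho t y)); last first.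
  by apply/funext => y; rewrite [LHS]mxE [in LHS]mxE [in LHS]mxE log_gradE.
apply: derivableB.
  have [db _] := b_C1.
  have /derivable_mxP := @diff_derivable _ _ _ b x (delta_mx ord0 i) (db x).
  exact.
apply: derivableZ; case: rho_C12 => _ d1 d2 _.
apply: derivableM; first exact: d2.
by apply: derivableV; [rewrite gt_eqF ?rho_gt0|exact: d1].
Qed.

(** The Fokker-Planck equation reads dt rho = - div (rho v). Expand by the product rule and divide
    by rho. *)
Lemma div_velocity t x : 0 <= t <= T ->
  div (velocity eps b rho t) x = - (dt T rho t x / rho t x) -
    \sum_i velocity eps b rho t x ord0 i * log_grad rho t x ord0 i.
Proof.
move=> tT; have r0 := rho_gt0 x tT.
have -> : dt T rho t x = - \sum_i (rho t x *
      partial i (fun y => velocity eps b rho t y ord0 i) x +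
    velocity eps b rho t x ord0 i * partial i (rho t) x).
  rewrite rho_FP// /div; congr (- _); apply: eq_bigr => i _.
  have fE : (fun y => (rho t y *: (b y - (eps / 2) *: log_grad rho t y)) ord0 i) =
      (rho t : E -> R) * (fun y => velocity eps b rho t y ord0 i).
    by apply/funext => y; rewrite velocityE// mxE.
  rewrite /partial fE deriveM; [by []| |exact: derivable_velocity].
  by case: rho_C12 => _ + _ _; exact.
rewrite mulNr opprK big_split /= mulrDl -mulr_sumr mulrAC divff ?gt_eqF// mul1r.
rewrite mulr_suml -addrA -sumrB -[LHS]addr0; congr (_ + _).
rewrite big1// => i _.
by rewrite log_gradE// mulrA subrr.
Qed.

(** With g = grad log rho and v = b - (eps/2) g, expanding the square gives |- b + eps g|^2 - |b|^2
    = - 2 eps v.g. *)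
Lemma div_velocity_drift t x : 0 <= t <= T ->
  dt T rho t x / rho t x + div (velocity eps b rho t) x =
  (2 * eps)^-1 * (sqnorm (- b x + eps *: log_grad rho t x) - sqnorm (b x)).
Proof.
move=> tT; rewrite div_velocity// addrA subrr add0r.
rewrite /sqnorm -sumrB mulr_sumr -sumrN; apply: eq_bigr => i _.
rewrite velocityE// !mxE.
by field; rewrite gt_eqF.
Qed.

End fokker_planck_identity.

(** * Continuous space-time fields evaluated along paths *)

Lemma continuous_pair (X Y Z : topologicalType) (f : X -> Y) (g : X -> Z) x :
  {for x, continuous f} -> {for x, continuous g} ->
  {for x, continuous (fun y => (f y, g y))}.
Proof. by move=> cf cg; exact: (cvg_pair cf cg). Qed.

Section along_paths.
Context {R : realType} {T : R} {d : nat}.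
Hypothesis T_ge0 : 0 <= T.
Local Notation path := (cpath T d).
Local Notation E := 'rV[R]_d.

(** Freezing the time outside [0, T] turns continuity relative to the cylinder into continuity on
    the whole space, which composes freely. *)
Definition clamp_continuous (f : R -> E -> R) : Prop :=
  continuous (fun p : R * E => f (clamp T p.1) p.2).

Lemma clamp_id t : 0 <= t <= T -> clamp T t = t.
Proof. by case/andP=> t0 tT; rewrite /clamp min_l// max_r. Qed.

Lemma clamp_ge0_le t : 0 <= clamp T t <= T.
Proof. by have := clamp_itv t T_ge0; rewrite in_itv. Qed.

Lemma clamp_subr t : T - clamp T t = clamp T (T - t).
Proof.
rewrite -clamp_rev// [RHS]clamp_id//; have /andP[t0 tT] := clamp_ge0_le t.
by rewrite subr_ge0 tT lerBlDr lerDl t0.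
Qed.

Lemma continuous_clamp : continuous (clamp T).
Proof.
move=> t; apply: (@continuous_max _ _ (fun=> 0) (fun t => Num.min t T)).
  exact: cst_continuous.
apply: (@continuous_min _ _ id (fun=> T)); first exact: cvg_id.
exact: cst_continuous.
Qed.

(** Clamping the time is a continuous map of the whole space into the cylinder, so relative
    neighbourhoods pull back to neighbourhoods. *)
Lemma cylinder_clamp_continuous f :
  cylinder_continuous T f -> clamp_continuous f.
Proof.
move=> /subspace_continuousP cf p.
have /cf : (`[0, T]%classic `*` [set: E]) (clamp T p.1, p.2).
  by split => //=; exact: clamp_itv.
apply: (@cvg_comp _ _ _ (fun p : R * E => (clamp T p.1, p.2))
  (fun p : R * E => f p.1 p.2)).
have cphi : {for p, continuous (fun p : R * E => (clamp T p.1, p.2))}.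
  apply: continuous_pair; last exact: cvg_snd.
  apply: (@continuous_comp _ _ _ fst (clamp T) p); first exact: cvg_fst.
  exact: continuous_clamp.
move=> A fA; have : \forall q \near p, (`[0, T]%classic `*` [set: E])
    (clamp T q.1, q.2) -> A (clamp T q.1, q.2) := cphi _ fA.
suff : \forall q \near p, (`[0, T]%classic `*` [set: E]) (clamp T q.1, q.2).
  by apply: filterS2 => q Dq; exact.
by near=> q; split => //=; exact: clamp_itv.
Unshelve. all: by end_near.
Qed.

Lemma clamp_continuous_rev f : clamp_continuous f ->
  clamp_continuous (fun t => f (T - t)).
Proof.
move=> cf p; rewrite (_ : (fun _ => _) =
  (fun p : R * E => f (clamp T p.1) p.2) \o (fun p => (T - p.1, p.2))).
  apply: (@continuous_comp _ _ _ (fun p : R * E => (T - p.1, p.2))); last exact: cf.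
  apply: continuous_pair; last exact: cvg_snd.
  by apply: cvgB; [exact: cvg_cst|exact: cvg_fst].
by apply/funext => q; rewrite clamp_subr.
Qed.

Lemma clamp_continuous_space (g : E -> R) :
  continuous g -> clamp_continuous (fun=> g).
Proof.
move=> cg p; apply: (@continuous_comp _ _ _ snd g); first exact: cvg_snd.
exact: cg.
Qed.

Lemma clamp_continuous_path f (w : path) : clamp_continuous f ->
  continuous (fun t => f (clamp T t) (w t)).
Proof.
move=> cf t; apply: (@continuous_comp _ _ _ (fun t => (t, w t))
  (fun p : R * E => f (clamp T p.1) p.2)); last exact: cf.
by apply: continuous_pair; [exact: cvg_id|exact: cpath_continuous].
Qed.

(** After clamping, each coordinate is measurable in the path at fixed time and continuous in time
    along a fixed path, which gives joint measurability. *)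
Lemma clamp_continuous_process (F : R -> E -> E) :
  (forall i, clamp_continuous (fun t x => F t x ord0 i)) ->
  measurable_process (fun t (w : path) => F t (w t)).
Proof.
move=> cF i; pose f t (w : path) : R := F (clamp T t) (w t) ord0 i.
apply: (eq_measurable_fun (fun p : measurableTypeR R * path => f p.1 p.2)).
  by move=> p; rewrite inE/= in_itv/= => -[pT _]; rewrite /f clamp_id.
apply: measurable_funTS; apply: measurable_fun_caratheodory => [t|w].
  apply: (measurableT_comp (f := fun x => F (clamp T t) x ord0 i)); last first.
    by apply: measurable_fun_rV => j; exact: measurable_eval.
  apply: continuous_measurable_rV => x.
  apply: (@continuous_comp _ _ _ (fun x => (t, x))
    (fun p : R * E => F (clamp T p.1) p.2 ord0 i)); last exact: (cF i).
  by apply: continuous_pair; [exact: cst_continuous|exact: cvg_id].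
exact: (@clamp_continuous_path _ w (cF i)).
Qed.

Lemma clamp_continuous_integrable f (w : path) : clamp_continuous f ->
  lebesgue_measure.-integrable `[0, T] (EFin \o (fun t => f t (w t))).
Proof.
move=> cf.
have : lebesgue_measure.-integrable `[0, T]
    (EFin \o (fun t => f (clamp T t) (w t))).
  apply: continuous_compact_integrable; first exact: segment_compact.
  by apply: continuous_subspaceT; exact: clamp_continuous_path.
apply: eq_integrable => // t; rewrite inE/= in_itv/= => tT.
by rewrite clamp_id.
Qed.

End along_paths.

Arguments clamp_continuous {R} T {d} f.

(** * Time integrals of the entropy production rate and of the drift energies *)

Section drift_energy.
Context {R : realType} {T eps : R} {d : nat}.
Local Notation path := (cpath T d).
Local Notation E := 'rV[R]_d.
Variables (b : E -> E) (rho : R -> E -> R).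
Hypothesis T_ge0 : 0 <= T.
Hypothesis eps_gt0 : 0 < eps.
Hypothesis b_C1 : C1_field b.
Hypothesis rho_gt0 : forall t x, 0 <= t <= T -> 0 < rho t x.
Hypothesis rho_C12 : C12 T rho.
Hypothesis rho_FP : fokker_planck T eps b rho.

Lemma drift_continuous i : clamp_continuous T (fun _ x => b x ord0 i).
Proof.
apply: clamp_continuous_space => x.
apply: (@continuous_comp _ _ _ b (fun y : E => y ord0 i)).
  by apply: differentiable_continuous; exact: b_C1.1.
exact: coord_continuous.
Qed.

Lemma clamp_continuous_div_rho f : clamp_continuous T f ->
  clamp_continuous T (fun t x => f t x / rho t x).
Proof.
move=> cf p; apply: cvgM; first exact: cf.
apply: continuousV.
  by rewrite gt_eqF// rho_gt0// clamp_ge0_le.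
by case: rho_C12 => _ _ _ [cr _ _ _]; exact: cylinder_clamp_continuous.
Qed.

Lemma log_grad_continuous i :
  clamp_continuous T (fun t x => log_grad rho t x ord0 i).
Proof.
have /clamp_continuous_div_rho cg :
    clamp_continuous T (fun t => partial i (rho t)).
  by case: rho_C12 => _ _ _ [_ _ cr _]; exact: cylinder_clamp_continuous.
move=> p; rewrite (_ : (fun _ => _) = fun p : R * E =>
  partial i (rho (clamp T p.1)) p.2 / rho (clamp T p.1) p.2); first exact: cg.
by apply/funext => q; rewrite (log_gradE rho_gt0 rho_C12)// clamp_ge0_le.
Qed.

Lemma reversed_drift_continuous i :
  clamp_continuous T (fun t x => reversed_drift T eps b rho t x ord0 i).
Proof.
have cg := clamp_continuous_rev T_ge0 (@log_grad_continuous i).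
move=> p; rewrite (_ : (fun _ => _) = fun p : R * E =>
  - b p.2 ord0 i + eps * log_grad rho (T - clamp T p.1) p.2 ord0 i); last first.
  by apply/funext => q; rewrite !mxE.
apply: cvgD; first by apply: cvgN; exact: drift_continuous.
by apply: cvgM; [exact: cvg_cst|exact: cg].
Qed.

Lemma reversed_velocity_continuous i :
  clamp_continuous T (fun t x => velocity eps b rho (T - t) x ord0 i).
Proof.
apply: (clamp_continuous_rev T_ge0 (f := fun t x => velocity eps b rho t x ord0 i)).
move=> p; rewrite (_ : (fun _ => _) = fun p : R * E =>
  b p.2 ord0 i - (eps / 2) * log_grad rho (clamp T p.1) p.2 ord0 i); last first.
  apply/funext => q; rewrite (velocityE _ _ rho_gt0 rho_C12) ?clamp_ge0_le//.
  by rewrite !mxE.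
apply: cvgB; first exact: drift_continuous.
by apply: cvgM; [exact: cvg_cst|exact: log_grad_continuous].
Qed.

Lemma clamp_continuous_sqnorm (F : R -> E -> E) :
  (forall i, clamp_continuous T (fun t x => F t x ord0 i)) ->
  clamp_continuous T (fun t x => sqnorm (F t x)).
Proof.
move=> cF p; rewrite /sqnorm; apply: cvg_big => [|i _].
  exact: add_continuous.
by rewrite /=; apply: cvgM; exact: cF.
Qed.

Local Notation mu := lebesgue_measure.

Lemma entropy_drift_energy (w : path) :
  \int[mu]_(t in `[0, T]) (dt T rho (T - t) (w t) / rho (T - t) (w t)) +
  \int[mu]_(t in `[0, T]) div (velocity eps b rho (T - t)) (w t) =
  (2 * eps)^-1 *
   (\int[mu]_(t in `[0, T]) sqnorm (reversed_drift T eps b rho t (w t)) -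
    \int[mu]_(t in `[0, T]) sqnorm (b (w t))).
Proof.
have cdt : clamp_continuous T (fun t x => dt T rho (T - t) x / rho (T - t) x).
  apply: (clamp_continuous_rev T_ge0 (f := fun t x => dt T rho t x / rho t x)).
  apply: clamp_continuous_div_rho.
  by case: rho_C12 => _ _ _ [_ cr _ _]; exact: cylinder_clamp_continuous.
have crd := clamp_continuous_sqnorm reversed_drift_continuous.
have cb := clamp_continuous_sqnorm (F := fun _ => b) drift_continuous.
have idt := clamp_continuous_integrable w cdt.
have ird := clamp_continuous_integrable w crd.
have ib := clamp_continuous_integrable w cb.
have cE : clamp_continuous T (fun t x =>
    sqnorm (reversed_drift T eps b rho t x) - sqnorm (b x)).
  by move=> p; apply: cvgB; [exact: crd|exact: cb].
have iE := clamp_continuous_integrable w cE.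
have cZ : clamp_continuous T (fun t x =>
    (2 * eps)^-1 * (sqnorm (reversed_drift T eps b rho t x) - sqnorm (b x))).
  by move=> p; apply: cvgM; [exact: cvg_cst|exact: cE].
have iZ := clamp_continuous_integrable w cZ.
(* The pointwise identity at time [T - t] expresses the divergence through fields already known to
   be continuous, hence integrable along [w], so that the integral can be split. *)
rewrite (@eq_Rintegral _ _ _ mu _ (fun t =>
  (2 * eps)^-1 * (sqnorm (reversed_drift T eps b rho t (w t)) - sqnorm (b (w t)))
  - dt T rho (T - t) (w t) / rho (T - t) (w t))
  (fun t => div (velocity eps b rho (T - t)) (w t))); last first.
  move=> t; rewrite inE/= in_itv/= => /andP[t0 tT].
  have Tt : 0 <= T - t <= T by rewrite subr_ge0 tT lerBlDr lerDl.
  rewrite /reversed_drift.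
  rewrite -(div_velocity_drift eps_gt0 b_C1 rho_gt0 rho_C12 rho_FP (w t) Tt).
  by rewrite addrAC subrr add0r.
rewrite (RintegralB _ iZ idt)// (RintegralZl _ _ iE)// (RintegralB _ ird ib)//.
by rewrite addrC subrK.
Qed.

End drift_energy.

(** * Change of measure and disintegration *)

Section change_of_measure.
Context {R : realType} d (Om : measurableType d).
Local Open Scope ereal_scope.

Lemma null_dominates_ae (m1 m2 : probability Om R) (Q : Om -> Prop) :
  m2 `<< m1 -> {ae m1, forall o, Q o} -> {ae m2, forall o, Q o}.
Proof.
move=> m21 [N [mN N0 QN]]; exists N; split => //.
by apply/measure0_null_setP => //; apply: m21; exact/measure0_null_setP.
Qed.

(** Passes from the derivative of sigma-finite measures, which has a change of variables formula, to
    the almost everywhere equal derivative of charges used to state Girsanov's formula. *)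
Lemma ge0_Radon_Nikodym_change_of_variables (nu mu : probability Om R)
    (f : Om -> \bar R) : nu `<< mu -> (forall o, 0 <= f o) ->
    measurable_fun setT f ->
  \int[nu]_o f o =
  \int[mu]_o (f o * Radon_Nikodym (charge_of_finite_measure nu) mu o).
Proof.
move=> numu f0 mf.
rewrite -(Radon_Nikodym_SigmaFinite.change_of_variables numu)//.
have mRN := measurable_int _ (Radon_Nikodym_SigmaFinite.f_integrable numu).
apply: ae_eq_integral => //.
- exact: emeasurable_funM.
- by apply: emeasurable_funM => //; apply: measurable_int; exact: Radon_Nikodym_integrable.
- by apply: ae_eqe_mul2l; exact: ae_eq_Radon_Nikodym_SigmaFinite.
Qed.

Lemma integral_Radon_Nikodym (nu mu : probability Om R) : nu `<< mu ->
  \int[mu]_o Radon_Nikodym (charge_of_finite_measure nu) mu o = 1.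
Proof.
move=> numu; rewrite -Radon_Nikodym_integral//.
exact: probability_setT.
Qed.

(* Integrate [S >= 1 - exp(-S)]. *)
Lemma expectation_ge0_of_exp (P : probability Om R) (S : {RV P >-> R}) :
  \int[P]_o (expR (- S o))%:E <= 1 -> 0 <= 'E_P[S].
Proof.
move=> eS; pose g o : \bar R := (1 - expR (- S o))%:E.
have mS : measurable_fun setT S by [].
have mexp : measurable_fun setT (fun o => expR (- S o)).
  by apply: measurableT_comp => //; exact: measurable_funN.
have mg : measurable_fun setT g.
  by apply/measurable_EFinP; apply: measurable_funB => //.
have iexp : P.-integrable setT (fun o => (expR (- S o))%:E).
  apply/integrableP; split; first exact/measurable_EFinP.
  under eq_integral do rewrite abse_EFin ger0_norm ?expR_ge0//.
  by rewrite (le_lt_trans eS)// ltry.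
have i1 : P.-integrable setT (cst (1%:E : \bar R)).
  exact: finite_measure_integrable_cst.
have ig : P.-integrable setT g.
  by rewrite /g; under eq_fun do rewrite EFinB; exact: integrableB.
have g_ge0 : 0 <= \int[P]_o g o.
  rewrite /g; under eq_integral do rewrite EFinB.
  have int1 : \int[P]_o (1%:E : \bar R) = 1.
    by rewrite integral_cst// mul1e; exact: probability_setT.
  by rewrite integralB// int1 sube_ge0 ?orbT.
have gS o : g o <= (S o)%:E.
  by rewrite lee_fin; have := expR_ge1Dx (- S o); lra.
(* [S] may have infinite expectation, so the two parts are compared separately: [g <= S] bounds the
   negative part of [S] by the integrable one of [g], and the positive part from below. *)
rewrite expectation_def integralE.
have gfin := integrable_neg_fin_num measurableT ig.
have neg_le : \int[P]_o (EFin \o S)^\- o <= \int[P]_o g^\- o.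
  apply: ge0_le_integral => //; try exact: measurable_funeneg.
  - by apply: measurable_funeneg; exact/measurable_EFinP.
  - by move=> o _; rewrite !funenegE ge_max !le_max lexx orbT andbT leeN2 gS.
have pos_le : \int[P]_o g^\+ o <= \int[P]_o (EFin \o S)^\+ o.
  apply: ge0_le_integral => //; try exact: measurable_funepos.
  - by apply: measurable_funepos; exact/measurable_EFinP.
  - by move=> o _; rewrite !funeposE ge_max !le_max gS lexx orbT.
rewrite sube_ge0; last first.
  by rewrite ge0_fin_numE ?integral_ge0// (le_lt_trans neg_le)// -ge0_fin_numE// integral_ge0.
apply: le_trans neg_le _; apply: le_trans pos_le.
by move: g_ge0; rewrite integralE sube_ge0// gfin.
Qed.

End change_of_measure.

(** * Disintegration with respect to the initial state *)

Section disintegration.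
Context {R : realType} {T : R} {d : nat}.
Hypothesis T_ge0 : 0 <= T.
Local Notation path := (cpath T d).
Local Notation E := 'rV[R]_d.
Variables (nu : probability path R) (nux : E -> probability path R).
Hypothesis nux_cond : is_conditional_law nu nux.
Local Open Scope ereal_scope.

(** The conditional law as a kernel from path space to itself, so that measurability of kernel
    integrals can be invoked under [nu]. *)
Let k (w : path) : {measure set path -> \bar R} := nux (w 0%R).

Lemma measurable_eval_rV t : measurable_fun setT (fun w : path => w t).
Proof. by apply: measurable_fun_rV => i; exact: measurable_eval. Qed.

Let mk U : measurable U -> measurable_fun setT (k ^~ U).
Proof.
move=> mU; apply: (measurableT_comp (f := fun x => nux x U)).
  exact: nux_cond.1.
exact: measurable_eval_rV.
Qed.

Lemma conditional_law_total A : measurable A ->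
  nu A = \int[nu]_w nux (w 0%R) A.
Proof.
move=> mA; have := nux_cond.2 A setT mA measurableT.
by rewrite (_ : [set w : path | setT (w 0%R)] = setT)// setIT.
Qed.

Import HBNNSimple.

Lemma integral_conditional_law_nnsfun (g : {nnsfun path >-> R}) :
  \int[nu]_w (g w)%:E = \int[nu]_w \int[nux (w 0%R)]_v (g v)%:E.
Proof.
under [RHS]eq_integral do rewrite integralT_nnsfun sintegralE.
rewrite integralT_nnsfun sintegralE ge0_integral_fsum//.
- apply: eq_fsbigr => r; rewrite inE => -[w _ gw].
  rewrite ge0_integralZl//.
  + by congr (_ * _); exact: conditional_law_total.
  + exact: mk.
  + by rewrite lee_fin -gw.
- by move=> r; apply: measurable_funeM; exact: mk.
- move=> r w _; have := mulemu_ge0 (mu := nux (w 0%R)) (fun r => g @^-1` [set r]).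
  by apply; exact: preimage_nnfun0.
Qed.

(** Approximate [f] from below by simple functions and use monotone convergence in the inner and in
    the outer integral. *)
Lemma integral_conditional_law (f : path -> \bar R) :
  (forall w, 0 <= f w) -> measurable_fun setT f ->
  \int[nu]_w f w = \int[nu]_w \int[nux (w 0%R)]_v f v.
Proof.
move=> f0 mf; pose f_ := nnsfun_approx measurableT mf.
have f_cvg w : (f_ n w)%:E @[n --> \oo] --> f w by exact: cvg_nnsfun_approx.
have f_nd w : {homo (fun n => (f_ n w)%:E) : m n / (m <= n)%N >-> m <= n}.
  by move=> m n mn; rewrite lee_fin; exact/lefP/nd_nnsfun_approx.
have mf_ n : measurable_fun setT (EFin \o f_ n) by exact/measurable_EFinP.
have limE (m : {measure set path -> \bar R}) :
    \int[m]_w f w = limn (fun n => \int[m]_w (f_ n w)%:E).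
  rewrite -monotone_convergence//.
  - by apply: eq_integral => w _; apply/esym/cvg_lim.
  - by move=> n w _; rewrite lee_fin.
rewrite limE (_ : (fun n => _) =
    fun n => \int[nu]_w \int[nux (w 0%R)]_v (f_ n v)%:E); last first.
  by apply/funext => n; exact: integral_conditional_law_nnsfun.
rewrite -monotone_convergence//.
- by apply: eq_integral => w _; rewrite limE.
- move=> n; apply: (measurable_fun_integral_kernel (l := k) mk) => [w|].
    by rewrite lee_fin.
  exact: mf_.
- by move=> n w _; apply: integral_ge0 => v _; rewrite lee_fin.
- move=> w _ m n mn; apply: ge0_le_integral.
  + by [].
  + by move=> v _; rewrite lee_fin.
  + exact: mf_.
  + exact: mf_.
  + by move=> v _; exact: f_nd.
Qed.

(** [nu N] is the integral of a nonnegative function, which must vanish almost everywhere if the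
    integral does. *)
Lemma conditional_law_null (N : set path) : measurable N -> nu N = 0 ->
  {ae nu, forall w : path, nux (w 0%R) N = 0}.
Proof.
move=> mN; rewrite conditional_law_total// => N0.
have mkN : measurable_fun setT (fun w : path => nux (w 0%R) N) by exact: mk.
have /(ae_eq_integral_abs nu measurableT mkN) :
    \int[nu]_w `|nux (w 0%R) N| = 0.
  by under eq_integral do rewrite gee0_abs//.
by apply: filterS => w /(_ Logic.I).
Qed.

Lemma conditional_law_ae (Q : path -> Prop) : {ae nu, forall w, Q w} ->
  {ae nu, forall w : path, {ae nux (w 0%R), forall v, Q v}}.
Proof.
move=> [N [mN N0 QN]]; apply: filterS (conditional_law_null mN N0) => w Nw0.
by exists N.
Qed.

Lemma conditional_law_integral1 (f : path -> \bar R) :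
  (forall w, 0 <= f w) -> measurable_fun setT f ->
  {ae nu, forall w : path, \int[nux (w 0%R)]_v f v = 1} -> \int[nu]_w f w = 1.
Proof.
move=> f0 mf f1; rewrite integral_conditional_law//.
rewrite (ae_eq_integral (cst 1))//.
- by rewrite integral_cst// mul1e; exact: probability_setT.
- exact: (measurable_fun_integral_kernel (l := k) mk).
- by apply: filterS f1 => w + _.
Qed.

(** The initial law has a density, so it does not charge Lebesgue null sets: assertions for almost
    every x become assertions about [w 0] for almost every path. *)
Lemma density_ae (rho : R -> E -> R) (Q : E -> Prop) :
  is_density nu rho -> measurable_fun setT (rho 0%R) ->
  {ae lebesgue_rV d, forall x, Q x} -> {ae nu, forall w : path, Q (w 0%R)}.
Proof.
move=> dens mrho [N [mN N0 QN]].
exists [set w : path | N (w 0%R)]; split.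
- by rewrite -[X in measurable X]setTI; exact: measurable_eval_rV.
- rewrite dens ?lexx// null_set_integral//.
  by apply/measurable_EFinP; exact: measurable_funTS.
- by move=> w /= nQ; apply: QN.
Qed.

End disintegration.

(** * Entropy production as a log-likelihood ratio *)

Section entropy_as_log_likelihood.
Context {R : realType} {T eps : R} {d : nat}.
Local Notation path := (cpath T d).
Local Notation E := 'rV[R]_d.
Variables (b : E -> E) (rho : R -> E -> R).
Hypothesis T_ge0 : 0 <= T.
Hypothesis eps_gt0 : 0 < eps.
Hypothesis b_C1 : C1_field b.
Hypothesis rho_gt0 : forall t x, 0 <= t <= T -> 0 < rho t x.
Hypothesis rho_C12 : C12 T rho.
Hypothesis rho_FP : fokker_planck T eps b rho.
Local Notation mu := lebesgue_measure.

Let V t (w : path) := velocity eps b rho (T - t) (w t).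
Let G t (w : path) := reversed_drift T eps b rho t (w t).

(** With g = grad log rho at time [T - t]: b = 2 (b - (eps/2) g) + (- b + eps g). *)
Lemma drift_decomposition t (w : path) : 0 <= t <= T ->
  b (w t) = 2 *: V t w + G t w.
Proof.
move=> /andP[t0 tT].
have Tt : 0 <= T - t <= T by rewrite subr_ge0 tT lerBlDr lerDl.
rewrite /V /G /reversed_drift (velocityE _ _ rho_gt0 rho_C12)//.
by apply/rowP => i; rewrite !mxE; field.
Qed.

(** Almost everywhere under [mux], exp(-S) times the density of [nux] is the density of [nurevx],
    whose integral is 1. [I] enters through simple processes converging under [mux], since it
    originates as an Ito integral under the unconditioned law. *)
Lemma integral_exp_entropy1 (nux nurevx mux : probability path R)
    (I S : path -> R) (A : nat -> simple_process T d) :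
  nux `<< mux -> mux `<< nux -> nurevx `<< mux ->
  girsanov_density eps (fun=> b) nux mux ->
  girsanov_density eps (reversed_drift T eps b rho) nurevx mux ->
  measurable_fun setT I -> measurable_fun setT S ->
  sp_approximates mux V A -> cvg_in_prob mux (fun n => sp_integral (A n)) I ->
  {ae nux, forall w, S w =
     \int[mu]_(t in `[0, T])
        (dt T rho (T - t) (w t) / rho (T - t) (w t))
      + 2 / eps * (I w + eps / 2 *
        \int[mu]_(t in `[0, T]) div (velocity eps b rho (T - t)) (w t))} ->
  (\int[nux]_w (expR (- S w))%:E = 1)%E.
Proof.
move=> nm mn rm [Ib [itob RNb]] [Ir [itor RNr]] mI mS AV AI SE.
have mV : measurable_process V.
  apply: (clamp_continuous_process T_ge0
    (F := fun t => velocity eps b rho (T - t))) => i.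
  exact: reversed_velocity_continuous.
have mG : measurable_process G.
  apply: (clamp_continuous_process T_ge0
    (F := reversed_drift T eps b rho)) => i.
  exact: reversed_drift_continuous.
have IE := ito_integral_comb T_ge0 mV mG drift_decomposition mI AV AI itor itob.
have mexp : measurable_fun setT (fun w => (expR (- S w))%:E).
  by apply/measurable_EFinP; apply: measurableT_comp => //; exact: measurable_funN.
rewrite (ge0_Radon_Nikodym_change_of_variables nm)//.
rewrite -(integral_Radon_Nikodym rm); apply: ae_eq_integral => //; first exact: emeasurable_funM.
have SEm := null_dominates_ae mn SE.
have joint : {ae mux, forall w, [/\ Ib w = 2 * I w + Ir w,
    S w = \int[mu]_(t in `[0, T])
        (dt T rho (T - t) (w t) / rho (T - t) (w t))
      + 2 / eps * (I w + eps / 2 *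
        \int[mu]_(t in `[0, T]) div (velocity eps b rho (T - t)) (w t)),
    Radon_Nikodym (charge_of_finite_measure nux) mux w =
      (expR (eps^-1 * Ib w - (2 * eps)^-1 *
        \int[mu]_(t in `[0, T]) sqnorm (b (w t))))%:E &
    Radon_Nikodym (charge_of_finite_measure nurevx) mux w =
      (expR (eps^-1 * Ir w - (2 * eps)^-1 *
        \int[mu]_(t in `[0, T]) sqnorm (reversed_drift T eps b rho t (w t))))%:E]}.
  by apply: filterS2 (filterI IE SEm) (filterI RNb RNr) => w [? ?] [? ?]; split.
apply: filterS joint => w [IbE SwE -> ->] _; rewrite -EFinM -expRD; congr (expR _)%:E.
(* The stochastic terms cancel because [Ib w = 2 * I w + Ir w]; the time integrals cancel by the
   energy identity. *)
have := entropy_drift_energy T_ge0 eps_gt0 b_C1 rho_gt0 rho_C12 rho_FP w.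
rewrite SwE IbE; set r := \int[mu]_(t in _) _; set v := \int[mu]_(t in _) _.
set q := \int[mu]_(t in _) _; set p := \int[mu]_(t in _) _ => rvE.
have -> : r = (2 * eps)^-1 * (q - p) - v by rewrite -rvE addrK.
by field; rewrite gt_eqF.
Qed.

End entropy_as_log_likelihood.

(** * Nonnegativity of the mean entropy production *)

Theorem theorem6p3 (R : realType) (d : nat) (eps T : R)
  (eps_gt0 : 0 < eps) (T_gt0 : 0 < T)
  (b : 'rV[R]_d -> 'rV[R]_d) (rho : R -> 'rV[R]_d -> R)
  (nu : probability (cpath T d) R)
  (nux nurevx mux : 'rV[R]_d -> probability (cpath T d) R)
  (nurev := distribution nu (time_reversal (ltW T_gt0)))
  (* the diffusion and the density of its one-time marginals *)
  (nu_law : is_diffusion_law eps (fun _ => b) nu)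
  (nu_density : is_density nu rho)
  (b_C1 : C1_field b)
  (rho_gt0 : forall (t : R) (x : 'rV[R]_d), 0 <= t <= T -> 0 < rho t x)
  (rho_C12 : C12 T rho)
  (rho_FP : fokker_planck T eps b rho)
  (* time reversal, conditioning on w(0) = x, and Girsanov's formula *)
  (nurev_law : is_diffusion_law eps (reversed_drift T eps b rho) nurev)
  (nux_cond : is_conditional_law nu nux)
  (nurevx_cond : is_conditional_law nurev nurevx)
  (mux_law : forall x, is_shifted_brownian_law eps x (mux x))
  (equiv : {ae lebesgue_rV d, forall x,
     [/\ nux x `<< mux x, mux x `<< nux x,
         nurevx x `<< mux x & mux x `<< nurevx x]})
  (girsanov : {ae lebesgue_rV d, forall x,
     girsanov_density eps (fun _ => b) (nux x) (mux x) /\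
     girsanov_density eps (reversed_drift T eps b rho) (nurevx x) (mux x)})
  (S : {RV nu >-> R})
  (S_stot : is_total_entropy_production eps b rho nu S) :
  (0 <= 'E_nu[S])%E.
Proof.
have T_ge0 := ltW T_gt0.
have [J [[I [[mI [A0 A0V] A0I] JE]] SE]] := S_stot.
pose V t (w : cpath T d) := velocity eps b rho (T - t) (w t).
have mV : measurable_process V.
  apply: (clamp_continuous_process T_ge0
    (F := fun t => velocity eps b rho (T - t))) => i.
  exact: reversed_velocity_continuous.
pose Y n w := (\int[lebesgue_measure]_(t in `[0%R, T])
  sqdist (sp_process (A0 n)) V t w)%E.
pose Z n w := (sp_integral (A0 n) w - I w)%:E.
have mY n : measurable_fun setT (Y n).
  apply: (measurable_integral_process (f := sqdist (sp_process (A0 n)) V)).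
    by move=> t w; rewrite lee_fin sqnorm_ge0.
  by apply: measurable_sqdist => //; exact: measurable_process_sp.
have mZ n : measurable_fun setT (Z n).
  apply/measurable_EFinP; apply: measurable_funB => //.
  exact: measurable_sp_integral.
(* Both the error [Y] of the integrand and the error [Z] of the integral become small almost surely
   along [phi]; the two exceptional sets are [nu]-null. *)
have [phi [Y0 Z0]] := vanish_in_prob_select mY mZ A0V (A0I _ A0V).
have mlim (X : nat -> cpath T d -> \bar R) : (forall n, measurable_fun setT (X n)) ->
    measurable (lim_sup_set (exceedance (X \o phi))).
  move=> mX; apply: bigcap_measurable => // n _.
  by apply: bigcup_measurable => k _; apply: measurable_level; exact: mX.
have Yx := conditional_law_null T_ge0 nux_cond (mlim _ mY) Y0.
have Zx := conditional_law_null T_ge0 nux_cond (mlim _ mZ) Z0.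
have mrho0 : measurable_fun setT (rho 0).
  apply: continuous_measurable_rV => x.
  have crho : clamp_continuous T rho.
    by case: rho_C12 => _ _ _ [cr _ _ _]; exact: cylinder_clamp_continuous.
  rewrite (_ : rho 0 = fun x => rho (clamp T 0) x); last first.
    by apply/funext => y; rewrite clamp_id// lexx.
  apply: (@continuous_comp _ _ _ (fun x => (0, x))
    (fun p : R * 'rV[R]_d => rho (clamp T p.1) p.2)); last exact: crho.
  by apply: continuous_pair; [exact: cst_continuous|exact: cvg_id].
have equivx := density_ae T_ge0 nu_density mrho0 equiv.
have girsanovx := density_ae T_ge0 nu_density mrho0 girsanov.
have SIE : {ae nu, forall w, S w =
     \int[lebesgue_measure]_(t in `[0, T])
        (dt T rho (T - t) (w t) / rho (T - t) (w t))
      + 2 / eps * (I w + eps / 2 *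
        \int[lebesgue_measure]_(t in `[0, T]) div (velocity eps b rho (T - t)) (w t))}.
  by apply: filterS2 SE JE => w -> ->.
have SIEx := conditional_law_ae T_ge0 nux_cond SIE.
have mS : measurable_fun setT S by [].
(* It remains to show that exp(-S) has mean at most 1 under [nu]; its mean is exactly 1 under almost
   every conditional law. *)
apply: expectation_ge0_of_exp.
rewrite (conditional_law_integral1 T_ge0 nux_cond)//.
  by apply/measurable_EFinP; apply: measurableT_comp => //; exact: measurable_funN.
apply: filterS3 (filterI equivx girsanovx) (filterI Yx Zx) SIEx => w.
move=> [[nm mn rm _] [gn gr]] [Yw Zw] SEw.
(* The exceptional sets are null for [nux (w 0)], hence for [mux (w 0)] by absolute continuity, and
   this restores convergence in probability under the latter. *)
have null (X : nat -> cpath T d -> \bar R) : (forall n, measurable_fun setT (X n)) ->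
    nux (w 0) (lim_sup_set (exceedance (X \o phi))) = 0%E ->
    vanish_in_prob (mux (w 0)) (X \o phi).
  move=> mX X0; apply: lim_sup_exceedance_vanish => [n|]; first exact: mX.
  apply/measure0_null_setP; first exact: mlim.
  by apply: mn; apply/measure0_null_setP => //; exact: mlim.
apply: (integral_exp_entropy1 T_ge0 eps_gt0 b_C1 rho_gt0 rho_C12 rho_FP
  nm mn rm gn gr mI mS (A := A0 \o phi)) => //.
- exact: null mY Yw.
- exact: null mZ Zw.
Qed.
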